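(* Let $n\ge 1$, $\pi\in S_n$ and $1\le\alpha<n$ be such that there exists $l>\alpha$ with $\pi\,t_{\alpha,l}\gtrdot\pi$. Then there exists a bijection \[\Phi_\pi:\operatorname{BPD}(\pi)\sqcup\coprod_{\substack{k<\alpha\\ \pi\,t_{k,\alpha}\gtrdot\pi}}\operatorname{BPD}(\pi\,t_{k,\alpha})\longrightarrow\coprod_{\substack{\alpha<l\\ \pi\,t_{l,\alpha}\gtrdot\pi}}\operatorname{BPD}(\pi\,t_{l,\alpha})\] such that: for every $D\in\operatorname{BPD}(\pi)$, $\Phi_\pi(D)$ has the same number of blank tiles as $D$ in every row other than row $\alpha$, and exactly one more blank tile than $D$ in row $\alpha$; and for every $D\in\operatorname{BPD}(\pi\,t_{k,\alpha})$ (with $k<\alpha$, $\pi\,t_{k,\alpha}\gtrdot\pi$), $\Phi_\pi(D)$ has the same number of blank tiles as $D$ in every row.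
   Context: A (reduced) bumpless pipe dream (BPD) of size $n$ is a tiling of the $n\times n$ grid (tiles indexed by matrix coordinates $(i,j)$, row $1$ at the top, column $1$ at the left) by six kinds of tiles: an r-tile (one pipe segment joining the bottom and right edges of the square), a j-tile (one pipe segment joining the top and left edges), a ''$+$''-tile (a vertical and a horizontal pipe crossing), a blank tile (no pipe), a ''$-$''-tile (a horizontal segment) and a ''$|$''-tile (a vertical segment), such that there are $n$ pipes in total, each pipe, travelling from south to east, starts vertically at the south edge of the grid and ends horizontally at the east edge, and no two pipes cross twice. Label the pipes $1,\dots,n$ along the south edge (left to right) and follow them to the east edge; reading the labels top to bottom along the east edge gives a permutation $\pi\in S_n$ ($\pi(i)$ is the label of the pipe exiting in row $i$). $\operatorname{BPD}(\pi)$ denotes the set of BPDs whose permutation is $\pi$. $t_{a,b}$ denotes the transposition of $a$ and $b$ (so $t_{a,b}=t_{b,a}$), $\pi\,t_{a,b}$ is the product in $S_n$ (swapping the values of $\pi$ in positions $a,b$), and $\gtrdot$ denotes the covering relation in Bruhat order. *)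

(* Defs.v *)
From HB Require Import structures.
From mathcomp Require Import all_boot all_fingroup.
From mathcomp Require Import matrix.

Set Implicit Arguments.
Unset Strict Implicit.
Unset Printing Implicit Defensive.

(* Rows, columns and pipe labels are 0-based: they live in 'I_n. *)

Variant edge : predArgType := North | East | South | West.

Definition edge_code (e : edge) : 'I_4 :=
  match e with
  | North => inord 0 | East => inord 1 | South => inord 2 | West => inord 3
  end.

Definition edge_decode (k : 'I_4) : edge :=
  match val k with 0 => North | 1 => East | 2 => South | _ => West end.

Lemma edge_codeK : cancel edge_code edge_decode.
Proof. by case; rewrite /edge_decode /edge_code /= inordK. Qed.

HB.instance Definition _ := Finite.copy edge (can_type edge_codeK).

Variant tile : predArgType :=
  RTile | JTile | CrossTile | BlankTile | HorTile | VertTile.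

Definition tile_code (t : tile) : 'I_6 :=
  match t with
  | RTile => inord 0 | JTile => inord 1 | CrossTile => inord 2
  | BlankTile => inord 3 | HorTile => inord 4 | VertTile => inord 5
  end.

Definition tile_decode (k : 'I_6) : tile :=
  match val k with
  | 0 => RTile | 1 => JTile | 2 => CrossTile
  | 3 => BlankTile | 4 => HorTile | _ => VertTile
  end.

Lemma tile_codeK : cancel tile_code tile_decode.
Proof. by case; rewrite /tile_decode /tile_code /= inordK. Qed.

HB.instance Definition _ := Finite.copy tile (can_type tile_codeK).

(* A pipe segment (e, e') of a tile is oriented along the south-to-east       *)
(* direction of travel: it enters the tile through e and leaves it through e'. *)
Definition segments (t : tile) : seq (edge * edge) :=
  match t with
  | RTile => [:: (South, East)]
  | JTile => [:: (West, North)]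
  | CrossTile => [:: (South, North); (West, East)]
  | BlankTile => [::]
  | HorTile => [:: (West, East)]
  | VertTile => [:: (South, North)]
  end.

Definition meets (t : tile) (e : edge) : bool :=
  has (fun s : edge * edge => (s.1 == e) || (s.2 == e)) (segments t).

Section BumplessPipeDreams.

Variable n : nat.

Implicit Types (D : 'M[tile]_n) (i j p q : 'I_n).

(* The segments glue to pipes that start exactly at the n south edges and end *)
(* exactly at the n east edges of the grid.                                   *)
Definition pipe_tiling D : bool :=
  [&& [forall i : 'I_n, forall j : 'I_n, forall j' : 'I_n, (j.+1 == j' :> nat) ==>
        (meets (D i j) East == meets (D i j') West)],
      [forall i : 'I_n, forall i' : 'I_n, forall j : 'I_n, (i.+1 == i' :> nat) ==>
        (meets (D i j) South == meets (D i' j) North)],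
      [forall i : 'I_n, forall j : 'I_n, (i == 0 :> nat) ==> ~~ meets (D i j) North],
      [forall i : 'I_n, forall j : 'I_n, (j == 0 :> nat) ==> ~~ meets (D i j) West],
      [forall i : 'I_n, forall j : 'I_n, (i.+1 == n) ==> meets (D i j) South]
    & [forall i : 'I_n, forall j : 'I_n, (j.+1 == n) ==> meets (D i j) East]].

(* A passage (i, j, s) is the segment s in the tile at (i, j). *)
Definition passage : finType := ('I_n * 'I_n * (edge * edge))%type.

Definition is_passage D (x : passage) : bool :=
  let: (i, j, s) := x in s \in segments (D i j).

Definition next_passage D : rel passage := fun x y =>
  let: (i, j, (_, out)) := x in
  let: (i', j', (into, _)) := y in
  [&& is_passage D x, is_passage D y &
      [&& out == North, into == South, i'.+1 == i :> nat & j' == j]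
   || [&& out == East, into == West, i' == i & j.+1 == j' :> nat]].

Definition pipe_through D p (x : passage) : bool :=
  [exists i0 : 'I_n, exists out : edge,
    [&& i0.+1 == n, is_passage D (i0, p, (South, out))
      & connect (next_passage D) (i0, p, (South, out)) x]].

Definition pipe_exits D p i : bool :=
  [exists j0 : 'I_n, exists into : edge,
    (j0.+1 == n) && pipe_through D p (i, j0, (into, East))].

Definition crossings D p q : {set 'I_n * 'I_n} :=
  [set c | (D c.1 c.2 == CrossTile) &&
    ((pipe_through D p (c, (South, North)) && pipe_through D q (c, (West, East)))
  || (pipe_through D q (c, (South, North)) && pipe_through D p (c, (West, East))))].

Definition is_bpd D : bool :=
  pipe_tiling D && [forall p : 'I_n, forall q : 'I_n, (p != q) ==> (#|crossings D p q| <= 1)].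

Definition has_perm D (pi : 'S_n) : bool := [forall i : 'I_n, pipe_exits D (pi i) i].

Definition BPD (pi : 'S_n) : Type := {D : 'M[tile]_n | is_bpd D && has_perm D pi}.

Definition row_blanks D i : nat := #|[set j : 'I_n | D i j == BlankTile]|.

End BumplessPipeDreams.

Section Bruhat.

Variable n : nat.

Implicit Types u v w : 'S_n.

(* The product u t_{a,b}, where (u t_{a,b})(x) = u (t_{a,b} x); MathComp       *)
(* composes permutations from left to right, hence the order of the factors.  *)
Definition mul_tperm u (a b : 'I_n) : 'S_n := (tperm a b * u)%g.

Definition perm_length u : nat :=
  #|[set x : 'I_n * 'I_n | (x.1 < x.2) && (u x.2 < u x.1)]|.

Definition bruhat_step : rel 'S_n := fun u w =>
  (perm_length u < perm_length w) &&
  [exists a : 'I_n, exists b : 'I_n, (a != b) && (w == mul_tperm u a b)].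

Definition bruhat_le : rel 'S_n := connect bruhat_step.

Definition bruhat_lt : rel 'S_n := fun u w => (u != w) && bruhat_le u w.

(* bruhat_covers w u is the covering relation "w covers u". *)
Definition bruhat_covers w u : bool :=
  bruhat_lt u w && ~~ [exists v : 'S_n, bruhat_lt u v && bruhat_lt v w].

End Bruhat.

Section Coproducts.

Variables (n : nat) (pi : 'S_n) (alpha : 'I_n).

Definition lower_index : Type :=
  {k : 'I_n | (k < alpha) && bruhat_covers (mul_tperm pi k alpha) pi}.

Definition upper_index : Type :=
  {l : 'I_n | (alpha < l) && bruhat_covers (mul_tperm pi l alpha) pi}.

Definition lower_BPD : Type :=
  {k : lower_index & BPD (mul_tperm pi (sval k) alpha)}.

Definition upper_BPD : Type :=
  {l : upper_index & BPD (mul_tperm pi (sval l) alpha)}.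

End Coproducts.

(* Main.v *)
Require Import Defs.
From mathcomp Require Import all_boot all_fingroup all_order all_algebra.
From mathcomp Require Import matrix.
From mathcomp Require Import mpoly.
From mathcomp Require Import zify ring.

Set Implicit Arguments.
Unset Strict Implicit.
Unset Printing Implicit Defensive.

Import GRing.Theory.

(** Since only the row statistics of the bijection are prescribed, it exists as
soon as the generating functions [F w], the sum over [D] in [BPD w] of the
monomials recording the blanks of [D] row by row, satisfy Monk's formula
[x_alpha * F pi = theta_alpha F pi], where [theta_alpha F w] is the signed sum
of the [F (w t_{alpha,j})] over the Bruhat covers (sign [+] for [j > alpha],
[-] for [j < alpha]).

A tiling is reduced iff at each crossing the horizontal pipe has the smaller
label: reading the labels along the boundary between processed and unprocessed
tiles gives a word that starts as the identity and in which a crossing swaps two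
adjacent letters.  Hence [F] is computed by row-to-row transfer of labels.

If [pi] increases after position [alpha], the rows below [alpha] are frozen and
an analysis of row [alpha] alone gives the formula (a transition formula with a
single upper term).  The general case follows by induction on the last descent
[r] of [pi]: writing [theta_r v = pi - sum_k v t_{k,r}] with [v] below [pi], the
commutation of [theta_alpha] and [theta_r] (the Dunkl elements of Fomin and
Kirillov acting by Bruhat operators) reduces the formula for [pi] at [alpha] to
formulas for [v], for the [v t_{k,r}], and to transition formulas at [r]. *)


(** * Labelled transfer matrices *)

(** What leaves a row is the last letter of the boundary word. So once a larger label stands left of
    a smaller one the pair is never exchanged again, and the smaller one must leave in a lower row.
    This principle removes every unwanted term of the transition formula.

    There, let [m] and [a] be the labels exchanged by the upper transposition. In the critical row
    of the larger permutation column [m] is empty. If no pipe arrives there along the row, a blank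
    is placed: this is the source of [x_alpha]. If a pipe [c] arrives, it must turn up into column
    [m], and renaming it [m] from then on yields a board of a lower term. Renaming is faithful when
    the lower transposition is a cover; when it is not, no board exists.

    With several upper covers this comparison no longer closes up. The induction avoids the
    difficulty: [v] is chosen so that its only upper cover at [r] is the given permutation, so
    [theta_r v] isolates the wanted value, and the terms of [theta_alpha v] still increase after
    [r], where a single upper cover is available. *)

Notation label := (option nat).

Section Transfer.

Local Open Scope ring_scope.

Variable R : comNzRingType.

Implicit Types (y : R) (K : seq label -> label -> R) (h v : label).
Implicit Types (acc vs top s : seq label) (c d a m : nat) (W E : seq nat).

(** Scans a row from left to right: [h] sits on the west edge of the next tile, [vs] below the tiles
    still to come, [acc] above those already placed. A sum of two branches stands for the two tiles
    compatible with the same input. Passing the finished row to a continuation [K] allows cutting a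
    row at any column and nesting rows. *)
Fixpoint row_transfer y K acc h vs : R :=
  if vs is v :: vs' then
    match h, v with
    | None, None => y * row_transfer y K (rcons acc None) None vs'
    | Some c, None => row_transfer y K (rcons acc (Some c)) None vs'
                    + row_transfer y K (rcons acc None) (Some c) vs'
    | None, Some b => row_transfer y K (rcons acc None) (Some b) vs'
                    + row_transfer y K (rcons acc (Some b)) None vs'
    | Some c, Some b =>
        if (c < b)%N then row_transfer y K (rcons acc (Some b)) (Some c) vs'
        else 0
    end
  else K acc h.

Definition labels s : seq nat := pmap id s.

Lemma labels_cat s1 s2 : labels (s1 ++ s2) = labels s1 ++ labels s2.
Proof. exact: pmap_cat. Qed.

Lemma labels_rcons s h : labels (rcons s h) = labels s ++ labels [:: h].
Proof. by rewrite -cats1 labels_cat. Qed.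

Lemma mem_labels s c : (c \in labels s) = (Some c \in s).
Proof.
elim: s => [|[b|] s IH] //=; rewrite !inE IH //.
Qed.

Lemma labels_map_Some W : labels (map Some W) = W.
Proof. by elim: W => //= w W ->. Qed.

(* A crossing exchanges two adjacent labels of the word read along the        *)
(* boundary [top edges, horizontal edge, bottom edges]; no other tile changes *)
(* that word.                                                                 *)
Definition swap_stable (P : seq nat -> Prop) :=
  forall A p q B, (p < q)%N -> P (A ++ p :: q :: B) -> P (A ++ q :: p :: B).

(** The basic tool for changing continuations: an invariant of the boundary word survives the row,
    so the continuations need to agree only on words that satisfy it. *)
Lemma eq_row_transfer (P : seq nat -> Prop) y K1 K2 acc h vs :
    swap_stable P ->
    (forall top h', P (labels (rcons top h')) -> K1 top h' = K2 top h') ->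
    P (labels (acc ++ h :: vs)) ->
  row_transfer y K1 acc h vs = row_transfer y K2 acc h vs.
Proof.
move=> Pst eqK; elim: vs acc h => [|v vs IH] acc h /=.
  by rewrite cats1; apply: eqK.
case: h v => [c|] [b|] HP /=.
- case: ifP => // cb; apply: IH; rewrite cat_rcons labels_cat /=.
  by apply: Pst => //; rewrite labels_cat in HP.
- by congr (_ + _); apply: IH; rewrite cat_rcons; move: HP; rewrite !labels_cat.
- by congr (_ + _); apply: IH; rewrite cat_rcons; move: HP; rewrite !labels_cat.
- by congr (_ * _); apply: IH; rewrite cat_rcons; move: HP; rewrite !labels_cat.
Qed.

Lemma swap_stable_perm S : swap_stable (fun W => perm_eq W S).
Proof.
move=> A p q B _; rewrite -(permPl (_ : perm_eq (A ++ p :: q :: B) _)) //.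
by rewrite perm_cat2l -[p :: q :: B]/([:: p] ++ [:: q] ++ B) perm_catCA.
Qed.

Lemma row_transfer_cat y K acc h s1 s2 :
  row_transfer y K acc h (s1 ++ s2) =
  row_transfer y (fun acc' h' => row_transfer y K acc' h' s2) acc h s1.
Proof.
elim: s1 acc h => [|v s1 IH] acc h //=.
by case: h v => [c|] [b|]; rewrite !IH.
Qed.

Lemma row_transfer0 y K acc h vs :
  (forall top h', K top h' = 0) -> row_transfer y K acc h vs = 0.
Proof.
move=> K0; elim: vs acc h => [|v vs IH] acc h //=.
by case: h v => [c|] [b|]; rewrite !IH ?addr0 ?mulr0 ?if_same.
Qed.

Lemma row_transfer_eq0 (P : seq nat -> Prop) y K acc h vs :
    swap_stable P ->
    (forall top h', P (labels (rcons top h')) -> K top h' = 0) ->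
    P (labels (acc ++ h :: vs)) ->
  row_transfer y K acc h vs = 0.
Proof.
move=> Pst K0 HP.
by rewrite (eq_row_transfer (K2 := fun _ _ => 0) y Pst K0) // row_transfer0.
Qed.

Lemma row_transferD y K1 K2 acc h vs :
  row_transfer y (fun t h => K1 t h + K2 t h) acc h vs =
  row_transfer y K1 acc h vs + row_transfer y K2 acc h vs.
Proof.
elim: vs acc h => [|v vs IH] acc h //=.
case: h v => [c|] [b|]; rewrite !IH; try ring.
by case: ifP => _; ring.
Qed.

Lemma row_transferZ y z K acc h vs :
  row_transfer y (fun t h => z * K t h) acc h vs = z * row_transfer y K acc h vs.
Proof.
elim: vs acc h => [|v vs IH] acc h //=.
case: h v => [c|] [b|]; rewrite !IH; try ring.
by case: ifP => _; ring.
Qed.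

Lemma row_transfer_sum (I : Type) (r : seq I) (P : pred I) y
    (K : I -> seq label -> label -> R) acc h vs :
  row_transfer y (fun t h => \sum_(i <- r | P i) K i t h) acc h vs =
  \sum_(i <- r | P i) row_transfer y (K i) acc h vs.
Proof.
elim: r => [|i r IH].
  by rewrite big_nil row_transfer0 // => *; rewrite big_nil.
rewrite big_cons -IH; case: ifP => Pi.
  rewrite -row_transferD; apply: (@eq_row_transfer (fun=> True)) => //.
  by move=> *; rewrite big_cons Pi.
by apply: (@eq_row_transfer (fun=> True)) => // *; rewrite big_cons Pi.
Qed.

Definition exits_at a K := forall top h, h <> Some a -> K top h = 0.

Lemma row_transfer_absent a y K acc h vs :
    exits_at a K -> Some a \notin h :: vs -> row_transfer y K acc h vs = 0.
Proof.
move=> Ka; elim: vs acc h => [|v vs IH] acc h /=.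
  by rewrite inE => /eqP ha; apply: Ka => /esym.
rewrite !inE !negb_or => /and3P[ah av avs].
have N1 : Some a \notin None :: vs by rewrite inE.
have Nh : Some a \notin h :: vs by rewrite inE negb_or ah.
have Nv : Some a \notin v :: vs by rewrite inE negb_or av.
by case: h v ah av Nh Nv => [c|] [b|] ? ? ? ?;
  rewrite !IH ?addr0 ?mulr0 ?if_same.
Qed.

(** A horizontal pipe cannot turn in an occupied column. So [d] is still horizontal at the column of
    [a], and crossing there sends [a] upward, away from its exit. *)
Lemma row_transfer_blocked a d y K acc W vs :
    exits_at a K -> d != a -> Some a \notin vs ->
  row_transfer y K acc (Some d) (map Some W ++ Some a :: vs) = 0.
Proof.
move=> Ka da avs; elim: W acc => [|b W IH] acc /=; last by rewrite IH if_same.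
rewrite (row_transfer_absent _ _ Ka) ?if_same //.
by rewrite inE negb_or avs andbT; apply/eqP=> -[] /esym/eqP; rewrite (negPf da).
Qed.

(** A pipe of [W] that turned east would run into the column of [a] and block it, so all of [W] goes
    straight up and [a] itself turns. *)
Lemma row_transfer_turn a y K acc W vs :
    exits_at a K -> a \notin W -> Some a \notin vs ->
  row_transfer y K acc None (map Some W ++ Some a :: vs) =
  row_transfer y K (acc ++ rcons (map Some W) None) (Some a) vs.
Proof.
move=> Ka + avs; elim: W acc => [|b W IH] acc /=.
  move=> _; rewrite (row_transfer_absent (h := None) _ _ Ka) ?addr0 ?cats1 //.
rewrite inE negb_or eq_sym => /andP[ba aW].
by rewrite row_transfer_blocked // add0r IH // cat_rcons.
Qed.

(** [a] may cross every pipe it meets, and turning up in an empty column would make it miss the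
    exit: one filling remains. *)
Lemma row_transfer_through a y K acc vs :
    exits_at a K -> (forall b, Some b \in vs -> (a < b)%N) ->
  row_transfer y K acc (Some a) vs = K (acc ++ vs) (Some a).
Proof.
move=> Ka; elim: vs acc => [|v vs IH] acc avs /=; first by rewrite cats0.
have avs' b : Some b \in vs -> (a < b)%N.
  by move=> bvs; apply: avs; rewrite inE bvs orbT.
case: v avs => [b|] avs; first by rewrite avs ?inE ?eqxx // IH // cat_rcons.
rewrite (row_transfer_absent (h := None) _ _ Ka) ?add0r ?IH ?cat_rcons //.
rewrite inE /=; apply/negP => /avs'; by rewrite ltnn.
Qed.

Variable x : nat -> R.

(** [E] lists the exits from the bottom row upward, so the row treated first has [size E'] rows
    above it, which is its 0-based index from the top. The final test forbids pipes through the
    north edge. *)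
Fixpoint boards_sum E s : R :=
  if E is e :: E' then
    row_transfer (x (size E'))
      (fun top h => if h == Some e then boards_sum E' top else 0) [::] None s
  else (all (pred1 None) s)%:R.

Definition next_rows E e top h : R :=
  if h == Some e then boards_sum E top else 0.

Lemma next_rows_exit E e : exits_at e (next_rows E e).
Proof. by move=> top h /eqP/negPf he; rewrite /next_rows he. Qed.

Lemma boards_sum_cons e E s :
  boards_sum (e :: E) s =
  row_transfer (x (size E)) (next_rows E e) [::] None s.
Proof. by []. Qed.

Lemma subseq2_cons (a b w : nat) W :
  subseq [:: a; b] (w :: W) = if a == w then b \in W else subseq [:: a; b] W.
Proof. by rewrite -[b \in W]sub1seq /=; case: eqP. Qed.

Lemma subseq2_rcons (a b : nat) W e :
  b != e -> subseq [:: a; b] (rcons W e) -> subseq [:: a; b] W.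
Proof.
move=> be; elim: W => [|w W IH] /=.
  by case: ifP => // _; rewrite sub1seq inE (negPf be).
case: ifP => _; last by exact: IH.
by rewrite !sub1seq mem_rcons inE (negPf be).
Qed.

Lemma subseq2_mem (a b : nat) W :
  subseq [:: a; b] W -> (a \in W) * (b \in W).
Proof. by move=> /mem_subseq sW; split; apply: sW; rewrite !inE eqxx ?orbT. Qed.

Lemma uniq_subseq2_antisym (a b : nat) W :
  uniq W -> subseq [:: a; b] W -> subseq [:: b; a] W -> False.
Proof.
elim: W => [|w W IH] //= /andP[wW uW].
have [Ea|aw] := eqVneq a w.
  subst a; rewrite sub1seq => bW; have [Eb|bw] := eqVneq b w.
    by rewrite Eb (negPf wW) in bW.
  by move=> /subseq2_mem[_]; rewrite (negPf wW).
have [Eb|bw] := eqVneq b w; last exact: IH.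
by subst b => /subseq2_mem[_]; rewrite (negPf wW).
Qed.

Lemma subseq2_swap (a b p q : nat) A B : ~~ ((p == a) && (q == b)) ->
  subseq [:: a; b] (A ++ p :: q :: B) -> subseq [:: a; b] (A ++ q :: p :: B).
Proof.
move=> npq; elim: A => [|w A IH]; rewrite !(cat0s, cat_cons) !subseq2_cons.
  rewrite !inE; move: npq; rewrite ![_ == a]eq_sym ![_ == b]eq_sym.
  case: (eqVneq a p) => ap; case: (eqVneq a q) => aq //=.
  - by rewrite -ap -aq.
  - by move=> /negPf ->.
  - by move=> _ ->; rewrite orbT.
by case: eqP => // _; rewrite !mem_cat !inE [(b == p) || _]orbCA.
Qed.

Lemma swap_stable_subseq c d S : (c < d)%N ->
  swap_stable (fun W => perm_eq W S /\ subseq [:: d; c] W).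
Proof.
move=> cd A p q B pq [permW sW]; split; first exact: swap_stable_perm permW.
by apply: subseq2_swap sW; apply/negP => /andP[/eqP pd /eqP qc]; lia.
Qed.

(* Two pipes d > c with d on the left can never cross again, so c exits lower. *)
Lemma next_rows_disordered E e c d top h :
    (forall s, uniq (labels s) -> subseq [:: d; c] (labels s) ->
       (index d E < index c E)%N -> boards_sum E s = 0) ->
    uniq (labels (rcons top h)) -> subseq [:: d; c] (labels (rcons top h)) ->
    (index d (e :: E) < index c (e :: E))%N ->
  next_rows E e top h = 0.
Proof.
move=> IH; rewrite /next_rows /=; case: (eqVneq h (Some e)) => [->|//].
rewrite labels_rcons /= cats1 => uW sW.
have [->|ec] := eqVneq e c; first by case: (c == d).
have sT : subseq [:: d; c] (labels top) by apply: subseq2_rcons sW; rewrite eq_sym.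
have [ed|ed] := eqVneq e d.
  by move: uW; rewrite rcons_uniq ed (subseq2_mem sT).1.
by rewrite ltnS; apply: IH => //; move: uW; rewrite rcons_uniq => /andP[].
Qed.

Lemma boards_sum_disordered E c d s :
    (c < d)%N -> uniq (labels s) -> subseq [:: d; c] (labels s) ->
    (index d E < index c E)%N ->
  boards_sum E s = 0.
Proof.
move=> cd; elim: E s => [|e E IH] s us sW lt_dc //.
rewrite boards_sum_cons.
apply: (row_transfer_eq0 _ (swap_stable_subseq (S := labels s) cd)) => //.
move=> top h [permW sW']; apply: next_rows_disordered lt_dc => //.
by rewrite (perm_uniq permW).
Qed.

(** * Renaming one pipe by a larger label *)

Definition relabel c m (z : nat) := if z == c then m else z.

Section Relabel.

Variables (c m : nat) (S : seq nat).
Hypotheses (cm : (c < m)%N) (uS : uniq S) (mS : m \notin S).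

(** Only labels strictly between [c] and [m] compare differently with the pipe after renaming. When
    they all stand to its left they are already out of order with [c] and never cross it. *)
Definition left_of_pipe W :=
  perm_eq W S /\ forall d, d \in S -> (c < d < m)%N -> subseq [:: d; c] W.

Lemma left_of_pipe_stable : swap_stable left_of_pipe.
Proof.
move=> A p q B pq [permW sW]; split; first exact: swap_stable_perm permW.
move=> d dS cdm; have /andP[cd _] := cdm.
by case: (swap_stable_subseq cd pq (conj permW (sW d dS cdm))).
Qed.

Lemma labels_relabel s : labels (map (omap (relabel c m)) s) = map (relabel c m) (labels s).
Proof. by elim: s => [|[b|] s IH] //=; rewrite IH. Qed.

(** Renaming creates new fillings, in which some [d] between [c] and [m] crosses the renamed pipe.
    Such a crossing leaves [m] left of the smaller [d] for good, and the second hypothesis makes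
    [K'] vanish on these words. *)
Lemma row_transfer_relabel y K K' acc h vs :
    (forall top h', left_of_pipe (labels (rcons top h')) ->
       K top h' = K' (map (omap (relabel c m)) top) (omap (relabel c m) h')) ->
    (forall d top h', d \in S -> (c < d < m)%N ->
       perm_eq (labels (rcons top h')) (map (relabel c m) S) ->
       subseq [:: m; d] (labels (rcons top h')) -> K' top h' = 0) ->
    left_of_pipe (labels (acc ++ h :: vs)) ->
  row_transfer y K acc h vs =
  row_transfer y K' (map (omap (relabel c m)) acc) (omap (relabel c m) h)
    (map (omap (relabel c m)) vs).
Proof.
move=> HK HK'; elim: vs acc h => [|v vs IH] acc h /=.
  by rewrite cats1 => /HK.
case: h v => [p|] [q|] HP /=; last first.
- rewrite IH ?map_rcons // cat_rcons; by move: HP; rewrite !labels_cat.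
- by rewrite !IH ?map_rcons // cat_rcons; move: HP; rewrite !labels_cat.
- by rewrite !IH ?map_rcons // cat_rcons; move: HP; rewrite !labels_cat.
have HP' : left_of_pipe (labels acc ++ p :: q :: labels vs).
  by move: HP; rewrite labels_cat.
have [permW HL] := HP'.
have uW : uniq (labels acc ++ p :: q :: labels vs) by rewrite (perm_uniq permW).
have pS : p \in S by rewrite -(perm_mem permW) mem_cat !inE eqxx orbT.
have qS : q \in S by rewrite -(perm_mem permW) mem_cat !inE eqxx !orbT.
have pm : p != m by apply: contraNneq mS => <-.
have qm : q != m by apply: contraNneq mS => <-.
have pq : p != q.
  by move: uW; rewrite cat_uniq => /and3P[_ _] /=; rewrite inE negb_or => /andP[/andP[]].
have spq : subseq [:: p; q] (labels acc ++ p :: q :: labels vs).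
  by apply: subseq_trans (suffix_subseq _ _); rewrite -[p :: q :: _]cat1s
     -[X in _ ++ X]cat1s catA prefix_subseq.
(* The test at a crossing changes only when [c] meets a label between [c] and [m]. With [c] on the
   left this contradicts [left_of_pipe]; with [c] on the right the crossing exists only after
   renaming and contributes zero. *)
case: (ltnP p q) => [ltpq|leqp].
  have -> : (relabel c m p < relabel c m q)%N.
    rewrite /relabel; have [pc|pc] := eqVneq p c; have [qc|qc] := eqVneq q c;
      try by clear -ltpq pc qc cm; lia.
    case: (ltnP q m) => [qltm|]; last by lia.
    exfalso; apply: (uniq_subseq2_antisym uW spq).
    by subst p; apply: HL => //; rewrite ltpq qltm.
  rewrite IH ?map_rcons // cat_rcons labels_cat.
  exact: (left_of_pipe_stable ltpq HP').
have [qc|qc] := eqVneq q c; last first.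
  have -> // : (relabel c m p < relabel c m q)%N = false.
  by rewrite /relabel (negPf qc); case: eqP; lia.
subst q; case: ifP => // rel_pq.
have cpm : (c < p < m)%N.
  by move: rel_pq; rewrite /relabel eqxx (negPf pq); lia.
have rp : relabel c m p = p by rewrite /relabel (negPf pq).
have rc : relabel c m c = m by rewrite /relabel eqxx.
rewrite rp rc in rel_pq *.
have ltpm : (p < m)%N by [].
symmetry; apply: (row_transfer_eq0 _ (swap_stable_subseq (S := map (relabel c m) S) ltpm)).
  by move=> top h' [permT sT]; rewrite (HK' p).
rewrite cat_rcons labels_cat /= !labels_relabel; split.
  have := map_cat (relabel c m) (labels acc) (c :: p :: labels vs).
  rewrite /= rp rc => <-; apply: perm_map.
  apply: perm_trans permW.
  by rewrite perm_cat2l -[c :: p :: _]/([:: c] ++ [:: p] ++ _) perm_catCA.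
by apply: subseq_trans (suffix_subseq _ _); rewrite /= !eqxx sub0seq.
Qed.

End Relabel.

Lemma omap_relabel_id c m s : c \notin labels s -> map (omap (relabel c m)) s = s.
Proof.
elim: s => [|[b|] s IH] //=; last by move=> /IH ->.
by rewrite inE negb_or eq_sym /relabel => /andP[/negPf -> /IH ->].
Qed.

Lemma map_relabel_id c m E : c \notin E -> map (relabel c m) E = E.
Proof.
elim: E => [|b E IH] //=.
by rewrite inE negb_or eq_sym /relabel => /andP[/negPf -> /IH ->].
Qed.

Lemma index_relabel c m E d :
  m \notin E -> d != m -> d != c -> index d (map (relabel c m) E) = index d E.
Proof.
move=> + dm dc; elim: E => [|b E IH] //=.
rewrite inE negb_or => /andP[mb mE]; rewrite IH // /relabel.
case: (eqVneq b c) => [->|_] //.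
by rewrite eq_sym (negPf dm) eq_sym (negPf dc).
Qed.

Lemma index_relabel_new c m E :
  m \notin E -> index m (map (relabel c m) E) = index c E.
Proof.
elim: E => [|b E IH] //=.
rewrite inE negb_or => /andP[mb mE]; rewrite IH // /relabel.
by case: (eqVneq b c) => [_|_]; rewrite ?eqxx // eq_sym (negPf mb).
Qed.

(** Each intermediate [d] stands left of [c] and leaves above it. A new crossing would put [m] left
    of [d] and force [d] to leave below, against the prescribed exits, so [boards_sum_disordered]
    discards it. *)
Lemma boards_sum_relabel E s c m :
    (c < m)%N -> uniq E -> m \notin E -> uniq (labels s) ->
    c \in labels s -> m \notin labels s ->
    (forall d, d \in labels s -> (c < d < m)%N ->
       subseq [:: d; c] (labels s) /\ (index c E < index d E)%N) ->
  boards_sum E s = boards_sum (map (relabel c m) E) (map (omap (relabel c m)) s).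
Proof.
move=> cm; elim: E s => [|e E IH] s uE mE us cs ms Hd.
  have sN b s' : b \in labels s' -> all (pred1 None) s' = false.
    by rewrite mem_labels => bs'; apply/negbTE/allPn; exists (Some b).
  rewrite /= (sN _ _ cs) (sN m) // labels_relabel.
  by apply/mapP; exists c; rewrite // /relabel eqxx.
move: uE mE; rewrite /= inE negb_or => /andP[eE uE] /andP[me mE].
rewrite -!/(next_rows _ _) size_map.
have rel_inj b : b != m -> (relabel c m b == relabel c m e) = (b == e).
  rewrite /relabel => bm.
  have [->|bc] := eqVneq b c; have [ec|ec] := eqVneq e c; rewrite ?eqxx //.
  - by rewrite (negPf me).
  - by rewrite (negPf bm) ec (negPf bc).
have uW top h : perm_eq (labels (rcons top h)) (labels s) ->
    [/\ uniq (labels (rcons top h)), m \notin labels (rcons top h)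
      & c \in labels (rcons top h)].
  by move=> p; rewrite (perm_uniq p) !(perm_mem p).
apply: (row_transfer_relabel (S := labels s)) => //; last first.
- by split=> // d ds cdm; case: (Hd d ds cdm).
- move=> d top h ds cdm permT sT.
  have [_ lt_cd] := Hd d ds cdm.
  have [dc dm dltm] : [/\ d != c, d != m & (d < m)%N] by clear -cdm; split; lia.
  apply: (@next_rows_disordered _ _ d m) sT _ => //.
  + by move=> s' us' ss' lt'; apply: boards_sum_disordered lt'.
  + rewrite (perm_uniq permT) map_inj_in_uniq // => a b aS bS.
    have am : a != m by apply: contraNneq ms => <-.
    have bm : b != m by apply: contraNneq ms => <-.
    by rewrite /relabel; clear -am bm; case: eqP => ?; case: eqP => ?; lia.
  + rewrite -map_cons index_relabel_new ?index_relabel ?inE ?negb_or ?me //.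
- move=> top h [permT HT]; have [uT mT cT] := uW _ _ permT.
  rewrite /next_rows.
  case: h permT HT uT mT cT => [b|] //= permT HT uT mT cT.
  have bm : b != m.
    by apply: contraNneq mT => <-; rewrite labels_rcons /= mem_cat inE eqxx orbT.
  rewrite -[Some b == _]/(b == e) -[Some _ == _]/(relabel c m b == relabel c m e).
  rewrite rel_inj //; case: eqP => // be; subst b.
  move: permT HT uT mT cT; rewrite labels_rcons /= cats1 rcons_uniq !mem_rcons !inE negb_or.
  move=> permT HT /andP[eT uT] /andP[_ mT] cT.
  (* Once [c] has left, renaming acts trivially on what remains. *)
  have [ec|ec] := eqVneq e c; first by subst e; rewrite omap_relabel_id // map_relabel_id.
  rewrite eq_sym (negPf ec) /= in cT.
  apply: IH => // d dT cdm.
  have ds : d \in labels s by rewrite -(perm_mem permT) mem_rcons inE dT orbT.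
  have [_ /=] := Hd d ds cdm; rewrite (negPf ec).
  case: (eqVneq e d) => // ed; rewrite ltnS; split => //.
  by apply: subseq2_rcons (HT d ds cdm); rewrite eq_sym.
Qed.

End Transfer.

(** * The transition formula *)

Section TransitionRow.

Local Open Scope ring_scope.

Variables (R : comNzRingType) (x : nat -> R) (m a : nat).
Variables (L : seq label) (M : seq nat) (S : seq label).
Hypotheses (ma : (m < a)%N) (Lm : forall b, Some b \in L -> (b < m)%N).
Hypotheses (Mm : forall b, b \in M -> (m < b < a)%N).
Hypotheses (Sa : forall b, Some b \in S -> (a < b)%N).

Lemma left_label_lt (top : seq label) h :
  perm_eq (labels (rcons top h)) (labels L) ->
  forall c, h = Some c -> (c < m)%N.
Proof.
move=> p c hc; apply: Lm; rewrite -mem_labels -(perm_mem p) hc labels_rcons.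
by rewrite mem_cat inE eqxx orbT.
Qed.

Let notin_right b : (b <= a)%N -> Some b \notin S.
Proof. by move=> ba; apply/negP => /Sa; lia. Qed.

Let notin_mid b : (b <= m)%N || (a <= b)%N -> b \notin M.
Proof. by move=> bm; apply/negP => /Mm; lia. Qed.

Let mem_mid (b : nat) : (Some b \in map Some M) = (b \in M).
Proof. by rewrite mem_map // => ? ? []. Qed.

(** The critical row of the larger permutation. A label [c] arriving at the empty column [m] must
    turn up, or it would block [a]; if none arrives, the tile there is blank and gives the factor
    [x (size E)]. *)
Lemma boards_sum_exit_right E :
  boards_sum x (a :: E) (L ++ None :: map Some M ++ Some a :: S) =
  row_transfer (x (size E)) (fun top h =>
    if h is Some c then boards_sum x E (top ++ Some c :: map Some M ++ None :: S)
    else x (size E) * boards_sum x E (top ++ None :: map Some M ++ None :: S))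
  [::] None L.
Proof.
rewrite boards_sum_cons row_transfer_cat.
apply: (eq_row_transfer _ (swap_stable_perm (S := labels L))) => //.
move=> top h /left_label_lt hm.
have Ka := @next_rows_exit R x E a.
have turn acc : row_transfer (x (size E)) (next_rows x E a) acc None
    (map Some M ++ Some a :: S) = boards_sum x E (acc ++ map Some M ++ None :: S).
  rewrite row_transfer_turn ?notin_mid ?notin_right ?leqnn ?orbT //.
  rewrite row_transfer_through // /next_rows eqxx.
  by rewrite -catA cat_rcons.
case: h hm => [c /(_ c erefl) cm|_] /=; last by rewrite turn cat_rcons.
rewrite turn row_transfer_blocked ?notin_right ?leqnn //; last by lia.
by rewrite addr0 cat_rcons.
Qed.

(** The same row when [m] exits: an arriving label would cross [m] and send it up, so nothing
    arrives and [m] turns. The row above is then that of the blank case of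
    [boards_sum_exit_right]. *)
Lemma boards_sum_exit_corner E :
  boards_sum x (m :: E) (L ++ Some m :: map Some M ++ None :: S) =
  row_transfer (x (size E)) (fun top h =>
    if h is Some c then 0
    else boards_sum x E (top ++ None :: map Some M ++ None :: S)) [::] None L.
Proof.
rewrite boards_sum_cons row_transfer_cat.
apply: (eq_row_transfer _ (swap_stable_perm (S := labels L))) => //.
move=> top h /left_label_lt hm.
have Ka := @next_rows_exit R x E m.
have mN : Some m \notin map Some M ++ None :: S.
  by rewrite mem_cat inE !negb_or mem_mid notin_mid ?leqnn // notin_right ?(ltnW ma).
case: h hm => [c /(_ c erefl) cm|_] /=.
  rewrite cm (row_transfer_absent _ _ Ka) // inE negb_or mN andbT.
  by apply/eqP => -[]; lia.
rewrite [X in _ + X](row_transfer_absent _ _ Ka) // addr0.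
rewrite row_transfer_through // /next_rows ?eqxx ?cat_rcons // => b.
rewrite mem_cat inE mem_mid => /orP[/Mm/andP[]//|/= /Sa]; lia.
Qed.

(** The same row for a lower term: [c] must be the arriving label and then crosses everything to its
    right. The outcome differs from [boards_sum_exit_right] only by [m] in place of [c] in column
    [m]. *)
Lemma boards_sum_exit_left E c : (c < m)%N ->
  boards_sum x (c :: E) (L ++ Some m :: map Some M ++ None :: S) =
  row_transfer (x (size E)) (fun top h =>
    if h == Some c then boards_sum x E (top ++ Some m :: map Some M ++ None :: S)
    else 0) [::] None L.
Proof.
move=> cm; rewrite boards_sum_cons row_transfer_cat.
apply: (eq_row_transfer _ (swap_stable_perm (S := labels L))) => //.
move=> top h /left_label_lt hm.
have Ka := @next_rows_exit R x E c.
have cN : Some c \notin map Some M ++ None :: S.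
  rewrite mem_cat inE !negb_or mem_mid notin_mid ?(ltnW cm) // notin_right //; lia.
case: h hm => [b /(_ b erefl) bm|_] /=.
  rewrite bm -[Some b == _]/(b == c); case: eqP => [->|bc].
    rewrite row_transfer_through // /next_rows ?eqxx ?cat_rcons // => d.
    rewrite mem_cat inE mem_mid => /orP[/Mm|/= /Sa]; lia.
  rewrite (row_transfer_absent _ _ Ka) // inE negb_or cN andbT.
  by apply/eqP => -[] /esym.
rewrite ![row_transfer _ _ _ _ _](row_transfer_absent _ _ Ka) ?addr0 //.
by rewrite inE negb_or cN andbT; apply/eqP => -[]; lia.
Qed.

End TransitionRow.

Lemma iota_split q n : (q < n)%N -> iota 0 n = iota 0 q ++ q :: iota q.+1 (n - q.+1).
Proof. by move=> qn; rewrite -[q :: _]/(iota (0 + q) _.+1) -iotaD; congr iota; lia. Qed.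

Section Transition.

Local Open Scope ring_scope.

Variables (R : comNzRingType) (x : nat -> R) (n : nat).
Implicit Types (u : 'S_n) (al i j k l : 'I_n) (Q : seq nat).

(** Combinatorial form of a Bruhat cover: the rectangle spanned by the two entries contains no other
    entry. [bruhat_coversE] identifies it with the covering relation. *)
Definition covers_at u i j : bool :=
  [&& (i < j)%N, (u i < u j)%N
    & [forall k : 'I_n, (i < k < j)%N ==> ~~ (u i < u k < u j)%N]].

Definition perm_word u : seq nat := [seq nat_of_ord (u i) | i <- enum 'I_n].

(** The overview's [F], named after the Schubert polynomials. The word is reversed because exits are
    read from the bottom row. *)
Definition schubert u : R :=
  boards_sum x (rev (perm_word u)) (map Some (iota 0 n)).

Definition column_state Q (c : nat) : label := if c \in Q then None else Some c.

Definition columns Q := map (column_state Q) (iota 0 n).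

Lemma columns_split Q q : (q < n)%N ->
  columns Q = map (column_state Q) (iota 0 q) ++ column_state Q q ::
    map (column_state Q) (iota q.+1 (n - q.+1)).
Proof.
move=> qn; rewrite -map_cons -map_cat; congr map.
exact: iota_split.
Qed.

(** Columns up to [q] are all occupied, so the pipes left of [q] go straight up while [q] turns and
    crosses all that remains on its right. The row has a single filling, without blanks. *)
Lemma columns_bottom_row E Q q : (q < n)%N -> (forall b, b \in Q -> (q < b)%N) ->
  boards_sum x (q :: E) (columns Q) = boards_sum x E (columns (q :: Q)).
Proof.
move=> qn qQ; rewrite !(columns_split _ qn).
have st b : (b <= q)%N -> column_state Q b = Some b.
  by rewrite /column_state => bq; case: ifP => // /qQ; lia.
rewrite st // [column_state (q :: Q) q]/column_state inE eqxx /=.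
have -> : map (column_state Q) (iota 0 q) = map Some (iota 0 q).
  by apply/eq_in_map => b; rewrite mem_iota => bq; rewrite st //; lia.
have -> : map (column_state (q :: Q)) (iota 0 q) = map Some (iota 0 q).
  apply/eq_in_map => b; rewrite mem_iota => bq.
  by rewrite /column_state inE -[RHS]st /column_state; [case: eqP => //; lia|lia].
have -> : map (column_state (q :: Q)) (iota q.+1 (n - q.+1)) =
          map (column_state Q) (iota q.+1 (n - q.+1)).
  apply/eq_in_map => b; rewrite mem_iota => bq.
  by rewrite /column_state inE; case: eqP => //; lia.
have right b : Some b \in map (column_state Q) (iota q.+1 (n - q.+1)) -> (q < b)%N.
  case/mapP => b'; rewrite mem_iota /column_state => /andP[qb _].
  by case: ifP => // _ [->].
rewrite -[row_transfer _ _ _ _ _]/(boards_sum x (q :: E) _) boards_sum_cons.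
have Kq := @next_rows_exit R x E q.
rewrite row_transfer_turn ?mem_iota ?ltnn ?andbF //; last first.
  by apply/negP => /right; rewrite ltnn.
by rewrite row_transfer_through // /next_rows eqxx cat_rcons.
Qed.

Lemma boards_sum_bottom E Q : sorted ltn Q -> all (ltn^~ n) Q ->
  boards_sum x (rev Q ++ E) (map Some (iota 0 n)) = boards_sum x E (columns Q).
Proof.
elim: Q E => [|q Q IH] E //= sQ /andP[qn Qn].
rewrite rev_cons cat_rcons IH ?(path_sorted sQ) //.
rewrite columns_bottom_row // => b bQ.
by move: sQ; rewrite (path_sortedE ltn_trans) => /andP[/allP/(_ b bQ)].
Qed.

Definition before al u : seq nat := [seq nat_of_ord (u i) | i : 'I_n <- enum 'I_n & (i < al)%N].
Definition after al u : seq nat := [seq nat_of_ord (u i) | i : 'I_n <- enum 'I_n & (al < i)%N].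

Lemma val_filter_ord (p : pred nat) :
  [seq val i | i <- [seq i <- enum 'I_n | p (val i)]] = [seq i <- iota 0 n | p i].
Proof. by rewrite -val_enum_ord filter_map. Qed.

Lemma filter_iota_lt (q : nat) : (q < n)%N -> [seq i <- iota 0 n | (i < q)%N] = iota 0 q.
Proof.
move=> qn; rewrite (iota_split qn) filter_cat /= ltnn.
rewrite (eq_in_filter (a2 := predT)) ?filter_predT; last first.
  by move=> i; rewrite mem_iota /=; lia.
rewrite (eq_in_filter (a2 := pred0)) ?filter_pred0 ?cats0 // => i.
by rewrite mem_iota /=; lia.
Qed.

Lemma filter_iota_gt (q : nat) : (q < n)%N ->
  [seq i <- iota 0 n | (q < i)%N] = iota q.+1 (n - q.+1).
Proof.
move=> qn; rewrite {1}(iota_split qn) filter_cat /= ltnn.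
rewrite (eq_in_filter (a2 := pred0)) ?filter_pred0 /=; last first.
  by move=> i; rewrite mem_iota /=; lia.
rewrite (eq_in_filter (a2 := predT)) ?filter_predT // => i.
by rewrite mem_iota /=; lia.
Qed.

Lemma enum_ord_split al :
  enum 'I_n = [seq i : 'I_n <- enum 'I_n | (i < al)%N] ++
              al :: [seq i : 'I_n <- enum 'I_n | (al < i)%N].
Proof.
apply: (inj_map val_inj); rewrite map_cat /= val_enum_ord.
rewrite (val_filter_ord (fun b => (b < al)%N)) (val_filter_ord (fun b => (al < b)%N)).
by rewrite filter_iota_lt // filter_iota_gt // -iota_split.
Qed.

Lemma perm_word_split al u :
  perm_word u = before al u ++ nat_of_ord (u al) :: after al u.
Proof. by rewrite /perm_word (enum_ord_split al) map_cat. Qed.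

Lemma perm_word_uniq u : uniq (perm_word u).
Proof. by rewrite map_inj_uniq ?enum_uniq // => i j /ord_inj/perm_inj. Qed.

Lemma mem_after al u i : (nat_of_ord (u i) \in after al u) = (al < i)%N.
Proof.
rewrite (@mem_map _ _ (fun i => nat_of_ord (u i))) => [|? ? /ord_inj/perm_inj //].
by rewrite mem_filter mem_enum andbT.
Qed.

Lemma mem_before al u i : (nat_of_ord (u i) \in before al u) = (i < al)%N.
Proof.
rewrite (@mem_map _ _ (fun i => nat_of_ord (u i))) => [|? ? /ord_inj/perm_inj //].
by rewrite mem_filter mem_enum andbT.
Qed.

Definition increasing_from (r : nat) u :=
  forall i j, (r <= i)%N -> (i < j)%N -> (u i < u j)%N.

(** From the bottom up, the exits below row [al] decrease, so each of these rows is forced by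
    [columns_bottom_row]. *)
Lemma schubert_frozen al u : increasing_from al.+1 u ->
  schubert u = boards_sum x (nat_of_ord (u al) :: rev (before al u)) (columns (after al u)).
Proof.
move=> inc; rewrite /schubert (perm_word_split al) rev_cat rev_cons cat_rcons.
rewrite boards_sum_bottom //; last by apply/allP => b /mapP[i _ ->] /=.
apply: (@homo_sorted_in _ _ (fun i => (al < i)%N) (fun i => nat_of_ord (u i))
          (relpre val ltn) ltn) => /=.
- by move=> i j ali _ ij; apply: inc.
- by apply/allP => i; rewrite mem_filter => /andP[].
- apply: sorted_filter => [i j k|]; first exact: ltn_trans.
  by rewrite -sorted_map val_enum_ord iota_ltn_sorted.
Qed.

Lemma size_before al u : size (before al u) = al.
Proof.
rewrite size_map -(size_map val) (val_filter_ord (fun b => (b < al)%N)).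
by rewrite filter_iota_lt ?size_iota.
Qed.

Lemma mul_tpermE u i j k : mul_tperm u i j k = u (tperm i j k).
Proof. by rewrite /mul_tperm permM. Qed.

Lemma val_perm_surj u (c : nat) : (c < n)%N -> exists i, c = nat_of_ord (u i).
Proof. by move=> cn; exists (u^-1%g (Ordinal cn)); rewrite permKV. Qed.

Lemma nth_before al u j : (j < al)%N -> nth 0%N (before al u) j = u j.
Proof.
move=> jal; have : nth 0%N (perm_word u) j = u j.
  by rewrite (nth_map j) ?size_enum_ord // nth_ord_enum.
by rewrite (perm_word_split al) nth_cat size_before jal.
Qed.

Lemma before_uniq al u : uniq (before al u).
Proof.
by have := perm_word_uniq u; rewrite (perm_word_split al) cat_uniq => /andP[].
Qed.

Lemma index_rev_before al u j : (j < al)%N ->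
  index (u j : nat) (rev (before al u)) = (al - j.+1)%N.
Proof.
move=> jal; have sz := size_before al u.
have -> : u j = nth 0%N (rev (before al u)) (al - j.+1) :> nat.
  by rewrite nth_rev sz ?nth_before //; [rewrite subnSK // subKn ?nth_before // ltnW|lia].
by rewrite index_uniq ?rev_uniq ?before_uniq // size_rev sz; lia.
Qed.

Lemma labels_columns Q (s : seq nat) :
  labels (map (column_state Q) s) = [seq c <- s | c \notin Q].
Proof.
rewrite /labels; elim: s => [|c s IH] //=; rewrite -IH.
by rewrite [column_state Q c]/column_state; case: (c \in Q).
Qed.

Lemma transition al l u : increasing_from al.+1 u -> covers_at u al l ->
  x al * schubert u + \sum_(k | covers_at u k al) schubert (mul_tperm u k al) =
  schubert (mul_tperm u al l).
Proof.
move=> inc /and3P[all_ ltu /forallP gap].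
set w := mul_tperm u al l; set m := nat_of_ord (u al); set a := nat_of_ord (u l).
have ma : (m < a)%N by [].
have an : (a < n)%N := ltn_ord _.
have mn : (m < n)%N := ltn_ord _.
have wal : w al = u l by rewrite mul_tpermE tpermL.
have wl : w l = u al by rewrite mul_tpermE tpermR.
have wD j : j != al -> j != l -> w j = u j by move=> ? ?; rewrite mul_tpermE tpermD // eq_sym.
(* Past [l] the entries exceed [a] by [inc], so the gap condition holds at every position after
   [al]. Hence the columns strictly between [m] and [a] are still occupied when row [al] is
   reached. *)
have gap_after j : (al < j)%N -> ~~ (m < u j < a)%N.
  move=> alj; case: (ltngtP j l) => [jl|lj|/val_inj ->].
  - by have /implyP := gap j; apply; rewrite alj.
  - by have := inc l j all_ lj; rewrite -/a; lia.
  - by rewrite -/a ltnn andbF.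
have inc_w : increasing_from al.+1 w.
  move=> i j ali ij; have alj : (al < j)%N by exact: ltn_trans ij.
  have nal k : (al < k)%N -> k != al by move=> h; rewrite -val_eqE /=; lia.
  have [il|il] := eqVneq i l.
    rewrite {1}il wl wD ?nal //; last by rewrite -val_eqE -il /=; lia.
    by have := inc i j ali ij; rewrite il -/a -/m; lia.
  have [jl|jl] := eqVneq j l; last by rewrite !wD ?nal //; apply: inc.
  rewrite jl wl wD ?nal // -/m; have := inc i j ali ij; rewrite jl -/a => ui.
  have := gap_after i ali; rewrite ui andbT -leqNgt leq_eqVlt => /orP[/eqP|//].
  by move=> /ord_inj/perm_inj ia; rewrite ia ltnn in ali.
have before_w : before al w = before al u.
  apply/eq_in_map => i; rewrite mem_filter => /andP[ial _].
  by rewrite wD // -val_eqE /=; lia.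
have afterP (c : nat) i : c = nat_of_ord (u i) -> (c \in after al u) = (al < i)%N.
  by move=> ->; rewrite mem_after.
have after_wP i : (nat_of_ord (u i) \in after al w) = (i == al) || (al < i)%N && (i != l).
  have -> : u i = w (tperm al l i) by rewrite mul_tpermE tpermK.
  rewrite mem_after; case: tpermP => [->|->|/eqP ial /eqP il].
  - by rewrite eqxx.
  - by rewrite ltnn eqxx andbF orbF -val_eqE /=; lia.
  - by rewrite (negPf ial) il andbT.
pose Q := after al u.
set L := map (column_state Q) (iota 0 m).
set M := iota m.+1 (a - m.+1).
set T := map (column_state Q) (iota a.+1 (n - a.+1)).
have colsplit f : map f (iota 0 n) = map f (iota 0 m) ++ f m :: map f M ++ f a ::
    map f (iota a.+1 (n - a.+1)).
  rewrite (iota_split mn) map_cat /=; congr (_ ++ _ :: _).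
  rewrite -map_cons -map_cat; congr map.
  have -> : (n - m.+1 = (a - m.+1) + (n - a.+1).+1)%N by lia.
  by rewrite iotaD subnKC.
have cols_u : columns Q = L ++ Some m :: map Some M ++ None :: T.
  rewrite /columns colsplit; congr (_ ++ _ :: _ ++ _ :: _).
  - by rewrite /column_state /Q mem_after ltnn.
  - apply/eq_in_map => c; rewrite mem_iota => mca.
    have [|j cj] := @val_perm_surj u c; first by lia.
    rewrite /column_state (afterP c j) //; case: ifP => // /gap_after; lia.
  - by rewrite /column_state /Q mem_after all_.
have cols_w : columns (after al w) = L ++ None :: map Some M ++ Some a :: T.
  rewrite /columns colsplit; congr (_ ++ _ :: _ ++ _ :: _).
  - apply/eq_in_map => c; rewrite mem_iota => cm.
    have [|j cj] := @val_perm_surj u c; first by lia.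
    rewrite /column_state (afterP c j) // cj after_wP.
    have -> : (j == al) = false by apply/eqP => E; move: cj cm; rewrite E -/m; lia.
    have -> : (j == l) = false by apply/eqP => E; move: cj cm; rewrite E -/a; lia.
    by rewrite andbT.
  - by rewrite /column_state after_wP eqxx.
  - apply/eq_in_map => c; rewrite mem_iota => mca.
    have [|j cj] := @val_perm_surj u c; first by lia.
    rewrite /column_state cj after_wP; case: ifP => // /orP[/eqP E|/andP[/gap_after]].
      by move: cj mca; rewrite E -/m; lia.
    by lia.
  - by rewrite /column_state after_wP eqxx andbF orbF -val_eqE /= gtn_eqF.
  - apply/eq_in_map => c; rewrite mem_iota => cm.
    have [|j cj] := @val_perm_surj u c; first by lia.
    rewrite /column_state (afterP c j) // cj after_wP.
    have -> : (j == al) = false by apply/eqP => E; move: cj cm; rewrite E -/m; lia.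
    have -> : (j == l) = false by apply/eqP => E; move: cj cm; rewrite E -/a; lia.
    by rewrite andbT.
have Lm b : Some b \in L -> [/\ (b < m)%N & b \notin Q].
  case/mapP => c; rewrite mem_iota /column_state => cm.
  by case: ifP => // cQ [->]; rewrite cQ.
have mL b : (b < m)%N -> b \notin Q -> Some b \in L.
  move=> bm bQ; apply/mapP; exists b; rewrite ?mem_iota //.
  by rewrite /column_state (negPf bQ).
have Lm1 b : Some b \in L -> (b < m)%N by case/Lm.
have Mm b : b \in M -> (m < b < a)%N by rewrite mem_iota; lia.
have Ta b : Some b \in T -> (a < b)%N.
  case/mapP => c; rewrite mem_iota /column_state => cm.
  by case: ifP => // _ [->]; lia.
set E := rev (before al u).
have sE : size E = al by rewrite size_rev size_before.
rewrite (schubert_frozen inc) (schubert_frozen inc_w) wal -/m -/a before_w -/E.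
rewrite cols_u cols_w (boards_sum_exit_right x ma Lm1 Mm Ta).
rewrite (boards_sum_exit_corner x ma Lm1 Mm Ta) sE.
(* The transposition trades the exits [u k] and [m], so the exits above row [al] are those of [u]
   with [u k] renamed [m]. *)
have schub_k k : covers_at u k al -> schubert (mul_tperm u k al) =
    row_transfer (x al) (fun top h => if h == Some (nat_of_ord (u k))
      then boards_sum x (map (relabel (u k) m) E)
        (top ++ Some m :: map Some M ++ None :: T) else 0) [::] None L.
  case/and3P=> kal ukm _.
  have v_al : mul_tperm u k al al = u k by rewrite mul_tpermE tpermR.
  have v_k : mul_tperm u k al k = u al by rewrite mul_tpermE tpermL.
  have v_D j : j != k -> j != al -> mul_tperm u k al j = u j.
    by move=> ? ?; rewrite mul_tpermE tpermD // eq_sym.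
  have v_after j : (al < j)%N -> mul_tperm u k al j = u j.
    by move=> alj; rewrite v_D // -val_eqE /=; lia.
  rewrite (@schubert_frozen al); last first.
    move=> i j ali ij; rewrite !v_after //; first exact: inc.
    exact: ltn_trans ij.
  rewrite v_al.
  have -> : after al (mul_tperm u k al) = Q.
    by apply/eq_in_map => j; rewrite mem_filter => /andP[alj _]; rewrite v_after.
  have -> : rev (before al (mul_tperm u k al)) = map (relabel (u k) m) E.
    rewrite /E map_rev; congr rev; rewrite -map_comp; apply/eq_in_map => j.
    rewrite mem_filter => /andP[jal _] /=; rewrite /relabel.
    have [->|jk] := eqVneq j k; first by rewrite v_k eqxx.
    rewrite v_D //; last by rewrite -val_eqE /=; lia.
    by rewrite val_eqE (inj_eq perm_inj) (negPf jk).
  by rewrite cols_u (boards_sum_exit_left x ma Lm1 Mm Ta) // size_map sE.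
rewrite (eq_bigr _ schub_k) -row_transfer_sum -row_transferZ -row_transferD.
apply: (eq_row_transfer _ (swap_stable_perm (S := labels L))) => //.
(* An empty edge at column [m] matches the term with factor [x al]. An arriving label [c] selects
   the one [k] with [u k = c]. *)
move=> top h permT; case: h permT => [c|] permT; last by rewrite big1 ?addr0.
rewrite mulr0 add0r.
have cL : Some c \in L.
  by rewrite -mem_labels -(perm_mem permT) labels_rcons mem_cat inE eqxx orbT.
have [cm cQ] := Lm c cL.
have [|k ck] := @val_perm_surj u c; first by lia.
have kal : (k < al)%N.
  move: cQ; rewrite ck mem_after -leqNgt leq_eqVlt => /orP[/eqP/val_inj kE|//].
  by move: cm; rewrite ck kE -/m ltnn.
have uE : uniq E by rewrite rev_uniq before_uniq.
have mE : m \notin E by rewrite mem_rev mem_before ltnn.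
set st := top ++ Some c :: _.
have labels_st : labels st = labels top ++ c :: M ++ labels T.
  by rewrite /st labels_cat /= labels_cat labels_map_Some.
have uTop : uniq (rcons (labels top) c).
  move: (perm_uniq permT); rewrite labels_rcons /= cats1 => ->.
  by rewrite labels_columns filter_uniq ?iota_uniq.
have top_lt d : d \in labels top -> (d < m)%N.
  move=> dT; apply: Lm1; rewrite -mem_labels -(perm_mem permT) labels_rcons.
  by rewrite mem_cat dT.
have [cT uT] : c \notin labels top /\ uniq (labels top).
  by move: uTop; rewrite rcons_uniq => /andP.
have T_gt d : d \in labels T -> (a < d)%N by rewrite mem_labels; apply: Ta.
have memMT d : d \in M ++ labels T -> (m < d)%N.
  by rewrite mem_cat => /orP[/Mm/andP[]//|/T_gt]; apply: ltn_trans.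
have ust : uniq (labels st).
  rewrite labels_st -cat_rcons cat_uniq uTop /=; apply/andP; split.
    apply/hasPn => d /memMT md; rewrite mem_rcons inE negb_or.
    rewrite gtn_eqF ?(ltn_trans cm) //=; apply/negP => /top_lt.
    by rewrite ltnNge (ltnW md).
  rewrite cat_uniq iota_uniq labels_columns filter_uniq ?iota_uniq // andbT /=.
  rewrite -labels_columns; apply/hasPn => d /T_gt ad.
  by apply/negP => /Mm/andP[_]; rewrite ltnNge (ltnW ad).
have between_top d : d \in labels st -> (c < d < m)%N -> d \in labels top.
  rewrite labels_st mem_cat inE => /orP[//|/orP[/eqP ->|/memMT md]].
    by rewrite ltnn.
  by rewrite [(d < m)%N]ltnNge (ltnW md) andbF.
have left_c d : d \in labels top -> subseq [:: d; c] (labels st).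
  move=> dT; rewrite labels_st -[[:: d; c]]/([:: d] ++ [:: c]).
  by apply: cat_subseq; rewrite sub1seq ?inE ?eqxx.
have sum_k : \sum_(k | covers_at u k al)
    (if Some c == Some (u k : nat) then boards_sum x (map (relabel (u k) m) E)
       (top ++ Some m :: map Some M ++ None :: T) else 0) =
    if covers_at u k al then boards_sum x (map (relabel c m) E)
       (top ++ Some m :: map Some M ++ None :: T) else 0.
  rewrite big_mkcond (bigD1 k) //= -ck eqxx big1 ?addr0 // => j jk.
  case: ifP => // _; case: eqP => // -[cj].
  by move: jk; rewrite -(inj_eq (@perm_inj _ u)) -val_eqE /= -cj ck eqxx.
rewrite {}sum_k; case: ifP => cov.
  symmetry; rewrite (@boards_sum_relabel _ _ _ _ c m) //.
  - have rc : relabel c m c = m by rewrite /relabel eqxx.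
    rewrite /st map_cat /= rc !omap_relabel_id //.
    rewrite labels_cat labels_map_Some; apply/negP => /memMT.
    by rewrite ltnNge (ltnW cm).
  - by rewrite labels_st mem_cat inE eqxx orbT.
  - rewrite labels_st mem_cat inE !negb_or; apply/and3P; split.
    + by apply/negP => /top_lt; rewrite ltnn.
    + by rewrite gtn_eqF.
    + by apply/negP => /memMT; rewrite ltnn.
  - move=> d dst cdm; have dT := between_top d dst cdm; split; first exact: left_c.
    have [|j dj] := @val_perm_surj u d.
      by apply: ltn_trans mn; case/andP: cdm.
    have dL : Some d \in L.
      by rewrite -mem_labels -(perm_mem permT) labels_rcons mem_cat dT.
    have jal : (j < al)%N.
      have [_] := Lm d dL; rewrite dj mem_after -leqNgt leq_eqVlt.
      by case/orP => [/eqP/ord_inj jE|//]; move: cdm; rewrite dj jE -/m ltnn andbF.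
    rewrite ck dj !index_rev_before //.
    (* The cover leaves no room for [d] between rows [k] and [al], so [d] exits above row [k]. *)
    suff jk : (j < k)%N by clear -jk jal kal; lia.
    case/and3P: cov => _ _ /forallP/(_ j); rewrite -ck -dj -/m cdm implybF.
    rewrite jal andbT -leqNgt leq_eqVlt => /orP[/eqP/ord_inj jk|//].
    by move: cdm; rewrite ck dj jk ltnn.
(* Not a cover: some [j] between [k] and [al] has its label between [c] and [m]. That label stands
   left of the smaller [c] and yet has to leave below it, so there is no board. *)
move/negbT: cov; rewrite /covers_at kal -/m -ck cm /= => /forallPn[j].
rewrite negb_imply negbK => /andP[/andP[kj jal] cjm].
symmetry; apply: (@boards_sum_disordered _ x E c (u j)) => //.
- by case/andP: cjm.
- apply: left_c.
  have : (u j : nat) \in labels (rcons top (Some c)).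
    rewrite (perm_mem permT) mem_labels mL //; first by case/andP: cjm.
    by rewrite mem_after -leqNgt ltnW.
  rewrite labels_rcons mem_cat inE => /orP[//|/eqP ujc].
  by move: cjm; rewrite ujc ltnn.
- by rewrite ck !index_rev_before //; clear -kj jal; lia.
Qed.

End Transition.

(** * Bruhat operators and their commutation *)

Section BruhatOperators.

Local Open Scope ring_scope.

Variables (n : nat).
Implicit Types (u v : 'S_n) (a b c d i j k l : 'I_n).

Lemma covers_atP u i j :
  reflect [/\ (i < j)%N, (u i < u j)%N
            & forall k, (i < k < j)%N -> ~~ (u i < u k < u j)%N]
          (covers_at u i j).
Proof.
apply: (iffP and3P) => -[ij uij gap]; split=> //.
  by move=> k; move/forallP/(_ k)/implyP: gap.
by apply/forallP => k; apply/implyP; apply: gap.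
Qed.

Lemma mul_tpermC u i j : mul_tperm u i j = mul_tperm u j i.
Proof. by rewrite /mul_tperm tpermC. Qed.

Lemma mul_tpermL u i j : mul_tperm u i j i = u j.
Proof. by rewrite mul_tpermE tpermL. Qed.

Lemma mul_tpermR u i j : mul_tperm u i j j = u i.
Proof. by rewrite mul_tpermE tpermR. Qed.

Lemma mul_tpermD u i j k : k != i -> k != j -> mul_tperm u i j k = u k.
Proof. by move=> ki kj; rewrite mul_tpermE tpermD // eq_sym. Qed.

Lemma val_perm_neq u i j : i != j -> (u i : nat) <> u j.
Proof. by move=> /eqP ij /ord_inj/perm_inj. Qed.

Lemma ord_neq i j : i != j -> (i : nat) <> j.
Proof. by move=> /eqP ij /ord_inj. Qed.

Lemma covers_at_disjoint v a b c d : a != c -> a != d -> b != c -> b != d ->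
  covers_at v a b -> covers_at (mul_tperm v a b) c d ->
  covers_at v c d && covers_at (mul_tperm v c d) a b.
Proof.
move=> ac ad bc bd /covers_atP[ab vab gap1] /covers_atP[cd].
rewrite !(@mul_tpermD v a b) 1?eq_sym // => vcd gap2.
have /= := (gap1 c, gap1 d, gap2 a, gap2 b).
rewrite mul_tpermL mul_tpermR => -[[[]]] g1c g1d g2a g2b.
have /= := (ord_neq ac, ord_neq ad, ord_neq bc, ord_neq bd).
have /= := (val_perm_neq (u := v) ac, val_perm_neq (u := v) ad,
  val_perm_neq (u := v) bc, val_perm_neq (u := v) bd).
move=> [[[n1 n2] n3] n4] [[[n5 n6] n7] n8].
apply/andP; split; apply/covers_atP; split=> //.
- move=> k ckd.
  have [E|ka] := eqVneq k a; first by subst k; clear gap1 gap2; lia.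
  have [E|kb] := eqVneq k b; first by subst k; clear gap1 gap2; lia.
  by have := gap2 k ckd; rewrite mul_tpermD.
- by rewrite !mul_tpermD.
- move=> k akb; rewrite (@mul_tpermD _ _ _ a) // (@mul_tpermD _ _ _ b) //.
  have [E|kc] := eqVneq k c; first by subst k; rewrite mul_tpermL; clear gap1 gap2; lia.
  have [E|kd] := eqVneq k d; first by subst k; rewrite mul_tpermR; clear gap1 gap2; lia.
  by rewrite mul_tpermD //; apply: gap1.
Qed.

Lemma covers_at_disjointC v a b c d : a != c -> a != d -> b != c -> b != d ->
  covers_at v a b && covers_at (mul_tperm v a b) c d =
  covers_at v c d && covers_at (mul_tperm v c d) a b.
Proof.
move=> ac ad bc bd; apply/idP/idP => /andP[].
  exact: covers_at_disjoint.
by apply: covers_at_disjoint; rewrite // eq_sym.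
Qed.

Section ThreePositions.

Variables (v : 'S_n) (a b c : 'I_n).

(** An open rectangle is empty apart from the three moved positions, so the condition is shared by
    [v] and all its products with transpositions of [a], [b], [c]. *)
Definition vacant (I J Y Z : nat) : bool :=
  [forall k : 'I_n, [&& k != a, k != b & k != c] ==>
     ~~ ((I < k < J) && (Y < v k < Z))%N].

Lemma vacant_split_position I J Y Z k : k \in [:: a; b; c] ->
  (I < k)%N -> (k < J)%N -> vacant I J Y Z = vacant I k Y Z && vacant k J Y Z.
Proof.
move=> kabc Ik kJ; apply/forallP/andP => [H|[/forallP H1 /forallP H2] i].
  by split; apply/forallP => i; apply/implyP => ni;
    have /implyP/(_ ni) := H i; clear H; lia.
apply/implyP => ni.
have /implyP/(_ ni) := H1 i; have /implyP/(_ ni) := H2 i.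
have : i != k by move: kabc; rewrite !inE => /or3P[]/eqP->; case/and3P: ni.
move=> /ord_neq; clear H1 H2; lia.
Qed.

Lemma vacant_split_value I J Y Z k : k \in [:: a; b; c] ->
  (Y < v k)%N -> (v k < Z)%N ->
  vacant I J Y Z = vacant I J Y (v k) && vacant I J (v k) Z.
Proof.
move=> kabc Yk kZ; apply/forallP/andP => [H|[/forallP H1 /forallP H2] i].
  by split; apply/forallP => i; apply/implyP => ni;
    have /implyP/(_ ni) := H i; clear H; lia.
apply/implyP => ni.
have /implyP/(_ ni) := H1 i; have /implyP/(_ ni) := H2 i.
have : i != k by move: kabc; rewrite !inE => /or3P[]/eqP->; case/and3P: ni.
move=> /(@val_perm_neq v); clear H1 H2; lia.
Qed.

Lemma covers_at_vacant u i j k :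
    [:: i; j; k] =i [:: a; b; c] -> k != i -> k != j ->
    (forall l, [&& l != a, l != b & l != c] -> u l = v l) ->
  covers_at u i j =
  [&& (i < j)%N, (u i < u j)%N, ~~ ((i < k < j) && (u i < u k < u j))%N
    & vacant i j (u i) (u j)].
Proof.
move=> ijk ki kj uv.
have out l : [&& l != a, l != b & l != c] = [&& l != i, l != j & l != k].
  by have := ijk l; rewrite !inE => /(congr1 negb); rewrite !negb_or => ->.
apply/covers_atP/and4P => [[ij uij gap]|[ij uij gapk /forallP gap]].
  split=> //; first by apply/negP => /andP[/gap/negP].
  apply/forallP => l; apply/implyP => /uv ul.
  by apply/negP => /andP[/gap]; rewrite ul => /negP.
split=> // l ilj; have [lk|lk] := eqVneq l k.
  by subst l; rewrite ilj in gapk.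
have lout : [&& l != a, l != b & l != c].
  by rewrite out lk -!val_eqE /= gtn_eqF ?ltn_eqF //; case/andP: ilj.
by have /implyP/(_ lout) := gap l; rewrite ilj (uv l lout).
Qed.

End ThreePositions.

Variable R : comNzRingType.

(** Antisymmetric in [i] and [j], like the generators of the Fomin-Kirillov algebra;
    [bruhat_operator] is then the Dunkl element [theta_i], acting on functions of permutations. *)
Definition cover_sign u i j : R := (covers_at u i j)%:R - (covers_at u j i)%:R.

Definition bruhat_operator (F : 'S_n -> R) i u : R :=
  \sum_j cover_sign u i j * F (mul_tperm u i j).

Lemma cover_sign_anti u i j : cover_sign u j i = - cover_sign u i j.
Proof. by rewrite /cover_sign opprB. Qed.

Lemma cover_sign_id u i : cover_sign u i i = 0.
Proof. by rewrite /cover_sign subrr. Qed.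

Lemma cover_sign_disjointC v a b c d : a != c -> a != d -> b != c -> b != d ->
  cover_sign v a b * cover_sign (mul_tperm v a b) c d =
  cover_sign v c d * cover_sign (mul_tperm v c d) a b.
Proof.
move=> ac ad bc bd.
have bM (p q : bool) : p%:R * q%:R = (p && q)%:R :> R.
  by case: p; case: q; rewrite ?mulr1 ?mulr0.
rewrite /cover_sign !mulrBl !mulrBr !bM.
have Hba p q : a != p -> a != q -> b != p -> b != q ->
    covers_at v b a && covers_at (mul_tperm v a b) p q =
    covers_at v p q && covers_at (mul_tperm v p q) b a.
  by move=> *; rewrite mul_tpermC covers_at_disjointC.
rewrite !Hba // (@covers_at_disjointC v a b c d) // (@covers_at_disjointC v a b d c) //.
rewrite !(mul_tpermC v d c); ring.
Qed.

(** The three products follow the three factorizations of one 3-cycle into two transpositions; this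
    is the three-term relation of the Fomin-Kirillov algebra. *)
Lemma cover_sign_triangle v a b c : a != b -> a != c -> b != c ->
  cover_sign v a b * cover_sign (mul_tperm v a b) b c +
  cover_sign v a c * cover_sign (mul_tperm v a c) b a =
  cover_sign v b c * cover_sign (mul_tperm v b c) a c.
Proof.
move=> ab ac bc; rewrite /cover_sign.
have ba : b != a by rewrite eq_sym.
have ca : c != a by rewrite eq_sym.
have cb : c != b by rewrite eq_sym.
have V := @covers_at_vacant v a b c.
have T1 : [:: a; b; c] =i [:: a; b; c] by [].
have T2 : [:: b; a; c] =i [:: a; b; c] by move=> i; rewrite !inE orbCA.
have T3 : [:: a; c; b] =i [:: a; b; c] by move=> i; rewrite !inE [(i == c) || _]orbC.
have T4 : [:: c; a; b] =i [:: a; b; c] by move=> i; rewrite !inE orbC -orbA.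
have T5 : [:: b; c; a] =i [:: a; b; c] by move=> i; rewrite !inE orbA orbC.
have T6 : [:: c; b; a] =i [:: a; b; c].
  by move=> i; rewrite !inE orbC -orbA orbCA.
have U0 l : [&& l != a, l != b & l != c] -> v l = v l by [].
have Uab l : [&& l != a, l != b & l != c] -> mul_tperm v a b l = v l.
  by case/and3P=> *; rewrite mul_tpermD.
have Uac l : [&& l != a, l != b & l != c] -> mul_tperm v a c l = v l.
  by case/and3P=> *; rewrite mul_tpermD.
have Ubc l : [&& l != a, l != b & l != c] -> mul_tperm v b c l = v l.
  by case/and3P=> *; rewrite mul_tpermD.
rewrite (V v a b c) // (V v b a c) // (V v a c b) // (V v c a b) //.
rewrite (V v b c a) // (V v c b a) //.
rewrite (V (mul_tperm v a b) b c a) // (V (mul_tperm v a b) c b a) //.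
rewrite (V (mul_tperm v a c) b a c) // (V (mul_tperm v a c) a b c) //.
rewrite (V (mul_tperm v b c) a c b) // (V (mul_tperm v b c) c a b) //.
rewrite !mul_tpermL !mul_tpermR !(@mul_tpermD v a b c) // !(@mul_tpermD v a c b) //.
rewrite !(@mul_tpermD v b c a) //.
have := ord_neq ab; have := ord_neq ac; have := ord_neq bc.
have := @val_perm_neq v _ _ ab; have := @val_perm_neq v _ _ ac.
have := @val_perm_neq v _ _ bc.
have VP k : k \in [:: a; b; c] -> _ := fun H I J Y Z => @vacant_split_position v a b c I J Y Z k H.
have VV k : k \in [:: a; b; c] -> _ := fun H I J Y Z => @vacant_split_value v a b c I J Y Z k H.
have ia : a \in [:: a; b; c] by rewrite !inE eqxx.
have ib : b \in [:: a; b; c] by rewrite !inE eqxx orbT.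
have ic : c \in [:: a; b; c] by rewrite !inE eqxx !orbT.
have Pa := VP a ia; have Pb := VP b ib; have Pc := VP c ic.
have Va := VV a ia; have Vb := VV b ib; have Vc := VV c ic.
clear V VP VV T1 T2 T3 T4 T5 T6 U0 Uab Uac Ubc ia ib ic ba ca cb ab ac bc.
move=> n1 n2 n3 n4 n5 n6.
have trans3 (p q r : nat) : (p < q)%N -> (q < r)%N -> (r < p)%N -> False by lia.
(* Once the relative order of the positions and of the values is fixed, every rectangle splits at
   [a], [b], [c] into common pieces, and the identity is checked on the vacancy of the pieces. *)
case: (ltngtP a b) => // lab; case: (ltngtP b c) => // lbc;
  case: (ltngtP a c) => // lac;
  try (by case: (trans3 _ _ _ lab lbc lac));
  try (by case: (trans3 _ _ _ lac lbc lab));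
case: (ltngtP (v a) (v b)) => // mab; case: (ltngtP (v b) (v c)) => // mbc;
  case: (ltngtP (v a) (v c)) => // mac;
  try (by case: (trans3 _ _ _ mab mbc mac));
  try (by case: (trans3 _ _ _ mac mbc mab)); rewrite /=;
  repeat match goal with
  | H1 : is_true (?I < nat_of_ord ?k)%N, H2 : is_true (nat_of_ord ?k < ?J)%N
    |- context [vacant v a b c ?I ?J ?Y ?Z] =>
      first [rewrite (Pa I J Y Z H1 H2) | rewrite (Pb I J Y Z H1 H2)
            | rewrite (Pc I J Y Z H1 H2)]
  | H1 : is_true (?Y < nat_of_ord ?k)%N, H2 : is_true (nat_of_ord ?k < ?Z)%N
    |- context [vacant v a b c ?I ?J ?Y ?Z] =>
      first [rewrite (Va I J Y Z H1 H2) | rewrite (Vb I J Y Z H1 H2)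
            | rewrite (Vc I J Y Z H1 H2)]
  end;
  repeat match goal with |- context [vacant v a b c ?I ?J ?Y ?Z] =>
    case: (vacant v a b c I J Y Z) end;
  rewrite /= ?subr0 ?sub0r ?subrr ?(mulr1, mulr0, mul0r, mulrN1, mul1r, addr0, add0r, oppr0, opprK, addNr, addrN) //.
Qed.

End BruhatOperators.

(** * Commutation of the Bruhat operators *)

Section Commutation.

Local Open Scope ring_scope.

Variables (n : nat) (R : comNzRingType).
Implicit Types (u v : 'S_n) (a b c i j k l : 'I_n) (F : 'S_n -> R).

Local Notation sg := (@cover_sign n R).

Lemma tperm_cycle v a b c : a != b -> a != c -> b != c ->
  mul_tperm (mul_tperm v a b) b c = mul_tperm (mul_tperm v a c) b a /\
  mul_tperm (mul_tperm v a b) b c = mul_tperm (mul_tperm v b c) a c.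
Proof.
move=> ab ac bc.
have [ba ca cb] : [/\ b != a, c != a & c != b] by rewrite ![_ == a]eq_sym [c == b]eq_sym.
have simp := (eqxx, negPf ab, negPf ac, negPf bc, negPf ba, negPf ca, negPf cb).
split; apply/permP => i; rewrite !mul_tpermE !permE /=.
all: have [E|ia] := eqVneq i a; [by do ?rewrite ?E !simp /=|].
all: have [E|ib] := eqVneq i b; [by do ?rewrite ?E !simp /=|].
all: have [E|ic] := eqVneq i c; [by do ?rewrite ?E !simp /=|].
all: by do ?rewrite ?(negPf ia, negPf ib, negPf ic) /=.
Qed.

(** Terms with disjoint transpositions cancel in pairs, and so do those using [t_{a,b}] twice. The
    rest is grouped by a third position [c] and vanishes by two triangle relations. *)
Lemma bruhat_operatorC F a b v :
  bruhat_operator (bruhat_operator F b) a v =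
  bruhat_operator (bruhat_operator F a) b v.
Proof.
have [->//|ab] := eqVneq a b; have ba : b != a by rewrite eq_sym.
pose A j m := sg v a j * (sg (mul_tperm v a j) b m * F (mul_tperm (mul_tperm v a j) b m)).
pose B j m := sg v b m * (sg (mul_tperm v b m) a j * F (mul_tperm (mul_tperm v b m) a j)).
pose X j m := A j m - B j m.
suff X0 : \sum_j \sum_m X j m = 0.
  apply/eqP; rewrite -subr_eq0 -[X in _ == X]X0; apply/eqP.
  rewrite /bruhat_operator.
  under eq_bigr => j _ do rewrite mulr_sumr.
  under [X in _ - X]eq_bigr => m _ do rewrite mulr_sumr.
  rewrite [X in _ - X]exchange_big /= -sumrB; apply: eq_bigr => j _.
  by rewrite -sumrB; apply: eq_bigr.
have Xa m : X a m = 0 by rewrite /X /A /B !cover_sign_id !mul0r mulr0 subrr.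
have Xb j : X j b = 0 by rewrite /X /A /B !cover_sign_id !mul0r mulr0 subrr.
have Xba : X b a = 0.
  rewrite /X /A /B (mul_tpermC v b a) !mulrA; apply/eqP; rewrite subr_eq0; apply/eqP.
  rewrite (cover_sign_anti R v a b) (cover_sign_anti R (mul_tperm v a b) a b).
  by rewrite (mul_tpermC (mul_tperm v a b) b a); ring.
have Xdis j m : j != a -> j != b -> m != a -> m != b -> j != m -> X j m = 0.
  move=> ja jb ma mb jm.
  rewrite /X /A /B !mulrA cover_sign_disjointC // 1?eq_sym //.
  suff -> : mul_tperm (mul_tperm v a j) b m = mul_tperm (mul_tperm v b m) a j by rewrite subrr.
  have [aj bj am bm mj] : [/\ a != j, b != j, a != m, b != m & m != j].
    by rewrite !(eq_sym a) !(eq_sym b) (eq_sym m j).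
  have simp := (eqxx, negPf aj, negPf bj, negPf am, negPf bm, negPf mj,
    negPf ja, negPf jb, negPf ma, negPf mb, negPf jm, negPf ab, negPf ba).
  apply/permP => i; rewrite !mul_tpermE !permE /=.
  have [E|ia] := eqVneq i a; first by do ?rewrite ?E !simp /=.
  have [E|ij] := eqVneq i j; first by do ?rewrite ?E !simp /=.
  have [E|ib] := eqVneq i b; first by do ?rewrite ?E !simp /=.
  have [E|im] := eqVneq i m; first by do ?rewrite ?E !simp /=.
  by do ?rewrite ?(negPf ia, negPf ij, negPf ib, negPf im) /=.
(* Of the six products, three reach one 3-cycle on [a], [b], [c] and three the other; [F1] and [F2]
   are the values of [F] there. *)
have Xtri c : c != a -> c != b -> X b c + (X c a + X c c) = 0.
  move=> ca cb; have [ac bc] : a != c /\ b != c by rewrite !(eq_sym _ c).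
  have [E1 E2] := tperm_cycle v ab ac bc.
  have [E3 E4] := tperm_cycle v ba bc ac.
  have T1 := @cover_sign_triangle n R v a b c ab ac bc.
  have T2 := @cover_sign_triangle n R v b a c ba bc ac.
  rewrite /X /A /B -E1 -E2 -E3 -E4 (mul_tpermC v b a) {E1 E2 E3 E4}.
  rewrite (mul_tpermC v b a) in T2.
  set F1 := F (mul_tperm _ b c); set F2 := F (mul_tperm _ a c).
  transitivity ((sg v a b * sg (mul_tperm v a b) b c + sg v a c * sg (mul_tperm v a c) b a
    - sg v b c * sg (mul_tperm v b c) a c) * F1 -
    (sg v b a * sg (mul_tperm v a b) a c + sg v b c * sg (mul_tperm v b c) a b
    - sg v a c * sg (mul_tperm v a c) b c) * F2); first by ring.
  by rewrite T1 T2 !subrr !mul0r subrr.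
have Xa0 : \sum_m X a m = 0 by apply: big1 => m _; apply: Xa.
rewrite (bigD1 a) //= Xa0 add0r (bigD1 b) //=.
rewrite (bigD1 a) //= Xba add0r (bigD1 b) //= Xb add0r.
rewrite [X in _ + X](eq_bigr (fun j => X j a + X j j)); last first.
  move=> j /andP[ja jb]; rewrite (bigD1 a) //= (bigD1 j) //=.
  rewrite [X in _ + (_ + X)]big1 ?addr0 // => m /andP[ma mj].
  have [->|mb] := eqVneq m b; first exact: Xb.
  by apply: Xdis; rewrite // eq_sym.
by rewrite -big_split /= big1 // => c /andP[ca cb]; apply: Xtri.
Qed.

End Commutation.

(** * Monk's formula *)

Section LastDescent.

Local Open Scope ring_scope.

Variable n : nat.
Implicit Types (u v : 'S_n) (al r s i j k l : 'I_n).

Definition ascends_after u al := exists2 j : 'I_n, (al < j)%N & (u al < u j)%N.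

(** The first larger entry after [al] has nothing in its rectangle. *)
Lemma covers_at_exists u al : ascends_after u al -> exists l, covers_at u al l.
Proof.
case=> j0 alj uj; pose P j := (al < j)%N && (u al < u j)%N.
have P0 : P j0 by rewrite /P alj.
case: (arg_minnP (fun j : 'I_n => val j) P0) => l /andP[all_ ul] lmin.
exists l; apply/covers_atP; split=> // k /andP[alk kl].
apply/negP => /andP[uk _]; have := lmin k; rewrite /P alk uk => /(_ isT) /=.
by rewrite leqNgt kl.
Qed.

(** Since the entries after [al] increase, the nearer of two candidates would lie in the rectangle
    of the farther one. *)
Lemma covers_at_unique u al l l' : increasing_from al.+1 u ->
  covers_at u al l -> covers_at u al l' -> l = l'.
Proof.
move=> inc /covers_atP[all_ ul gap] /covers_atP[all' ul' gap'].
case: (ltngtP l l') => [ll'|l'l|/ord_inj//].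
  by have := gap' l; rewrite all_ ll' ul inc // => /(_ isT).
by have := gap l'; rewrite all' l'l ul' inc // => /(_ isT).
Qed.

(** Its cardinality is the measure of the inner induction of [monk]. *)
Definition descents_at u r : {set 'I_n} := [set j : 'I_n | (r < j)%N && (u j < u r)%N].

Lemma increasing_from_leq (p q : nat) u : (p <= q)%N ->
  increasing_from p u -> increasing_from q u.
Proof. by move=> pq inc i j qi ij; apply: inc => //; apply: leq_trans qi. Qed.

Lemma no_descents_increasing u r : increasing_from r.+1 u ->
  descents_at u r = set0 -> increasing_from r u.
Proof.
move=> inc d0 i j; rewrite leq_eqVlt => /orP[/eqP/ord_inj <- rj|ri ij]; last exact: inc.
have : j \notin descents_at u r by rewrite d0 inE.
rewrite inE rj /= -leqNgt leq_eqVlt => /orP[/eqP/ord_inj/perm_inj E|//].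
by rewrite E ltnn in rj.
Qed.

Section Step.

Variables (u : 'S_n) (r s : 'I_n).
Hypotheses (inc : increasing_from r.+1 u).
Hypotheses (rs : (r < s)%N) (us : (u s < u r)%N).
Hypothesis smax : forall j, (r < j)%N -> (u j < u r)%N -> (j <= s)%N.

Let v := mul_tperm u r s.

Let vr : v r = u s. Proof. exact: mul_tpermL. Qed.
Let vs : v s = u r. Proof. exact: mul_tpermR. Qed.
Let vD j : j != r -> j != s -> v j = u j. Proof. exact: mul_tpermD. Qed.

Let nr j : (r < j)%N -> j != r.
Proof. by move=> rj; rewrite -val_eqE /= gtn_eqF. Qed.

(** By the choice of [s], the entries beyond [s] exceed [u r], while those between [r] and [s] are
    below [u s]; so [u r] fits at position [s]. *)
Lemma step_increasing : increasing_from r.+1 v.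
Proof.
move=> i j ri ij; have rj := ltn_trans ri ij.
have [is_|is_] := eqVneq i s.
  have js : j != s by rewrite -val_eqE /= -is_ gtn_eqF.
  rewrite is_ vs (vD (nr rj) js) ltnNge; apply/negP; rewrite leq_eqVlt.
  case/orP => [/eqP/ord_inj/perm_inj E|ujr]; first by move: rj; rewrite E ltnn.
  by have := smax rj ujr; rewrite leqNgt -is_ ij.
rewrite (vD (nr ri) is_); have [js|js] := eqVneq j s.
  by rewrite js vs; apply: ltn_trans us; rewrite -js; apply: inc.
by rewrite vD ?nr //; apply: inc.
Qed.

Lemma step_covers l : covers_at v r l = (l == s).
Proof.
have cov : covers_at v r s.
  apply/covers_atP; rewrite vr vs; split=> // k /andP[rk ks].
  have ks' : k != s by rewrite -val_eqE /= ltn_eqF.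
  by rewrite vD ?nr // negb_and -!leqNgt ltnW //; apply: inc.
apply/idP/eqP => [|->//] covl; apply: covers_at_unique covl cov.
exact: step_increasing.
Qed.

(** Stated for [w] so as to serve both [v] and the [v t_{k,r}]. The position [s] drops out because
    it now carries [u r]. *)
Lemma step_descents (w : 'S_n) :
    (forall j, (r < j)%N -> w j = v j) -> (w r <= u s)%N ->
  (#|descents_at w r| < #|descents_at u r|)%N.
Proof.
move=> wv wr; apply: proper_card; apply/properP; split.
  apply/subsetP => j; rewrite !inE => /andP[rj]; rewrite wv // rj /=.
  have [->|js] := eqVneq j s.
    by rewrite vs => H; have := leq_trans (ltn_trans us H) wr; rewrite ltnn.
  by rewrite vD ?nr // => H; apply: ltn_trans us; apply: leq_trans H wr.
exists s; rewrite !inE rs //= wv // vs -leqNgt.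
exact: leq_trans wr (ltnW us).
Qed.

Variable al : 'I_n.
Hypotheses (alr : (al < r)%N) (asc : ascends_after u al).

Lemma step_ascends : ascends_after v al.
Proof.
case: asc => j alj uj; exists (tperm r s j).
  by case: tpermP => // _; apply: ltn_trans rs.
by rewrite /v (mul_tpermE u r s (tperm r s j)) tpermK vD // -val_eqE /= ltn_eqF //; apply: ltn_trans rs.
Qed.

(** Position [s], which carries [u r], is a witness unless [al] differs from [k] and [u al] is at
    least [u r]; in that case the old witness for [u] is untouched by both swaps. *)
Lemma step_lower_ascends k : covers_at v k r -> ascends_after (mul_tperm v k r) al.
Proof.
case/covers_atP=> kr vkr _.
have val : v al = u al by rewrite vD // -val_eqE /= ltn_eqF //; apply: ltn_trans rs.
have wk : mul_tperm v k r k = v r by apply: mul_tpermL.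
have wr : mul_tperm v k r r = v k by apply: mul_tpermR.
have sr : s != r by exact: nr.
have sk : s != k by rewrite -val_eqE /= gtn_eqF // (ltn_trans kr).
have ws : mul_tperm v k r s = u r by rewrite mul_tpermD.
have als : (al < s)%N by apply: ltn_trans rs.
have [alk|alk] := eqVneq al k.
  by exists s => //; rewrite ws alk wk vr.
have wal : mul_tperm v k r al = u al.
  by rewrite mul_tpermD // -val_eqE /= ltn_eqF.
have [uas|ura] := ltnP (u al) (u r); first by exists s; rewrite ?ws ?wal.
case: asc => j alj uj.
have [jr js] : j != r /\ j != s.
  split; apply/eqP => E; move: uj; rewrite E ltnNge ?ura //.
  by rewrite (leq_trans (ltnW us)).
exists j; rewrite ?wal //; have [jk|jk] := eqVneq j k.
  have := vkr; rewrite -jk vD // vr => ujs.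
  by have := ltn_trans (ltn_trans uj ujs) us; rewrite ltnNge ura.
by rewrite mul_tpermD // vD.
Qed.

(** Makes [monk_increasing] applicable at [r] to each term of [theta_al v]. If [l] lies beyond [r],
    the gap condition lets [v al] take the place of [v l] in the increasing tail. *)
Lemma step_commuting_upper l : covers_at v al l || covers_at v l al ->
  increasing_from r.+1 (mul_tperm v al l) /\ ascends_after (mul_tperm v al l) r.
Proof.
set w := mul_tperm v al l => cov.
have incv := step_increasing.
have vrs : (v r < v s)%N by rewrite vr vs.
have wal : w al = v l by apply: mul_tpermL.
have wl : w l = v al by apply: mul_tpermR.
have wD j : j != al -> j != l -> w j = v j by apply: mul_tpermD.
have nal j : (r <= j)%N -> j != al.
  by move=> rj; rewrite -val_eqE /= gtn_eqF //; apply: leq_trans rj.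
case: (leqP l r) => [lr|rl].
  have wj j : (r < j)%N -> w j = v j.
    by move=> rj; rewrite wD ?nal ?(ltnW rj) // -val_eqE /= gtn_eqF // (leq_ltn_trans lr).
  split; first by move=> i j ri ij; rewrite !wj ?incv // (ltn_trans ri).
  exists s => //; rewrite (wj s rs); have [E|lr'] := eqVneq r l; last by rewrite wD ?nal.
  rewrite E wl; apply: ltn_trans vrs; rewrite E.
  case/orP: cov => /covers_atP[] //.
  by rewrite -E ltnNge (ltnW alr).
have {cov} /covers_atP[all_ vl gap] : covers_at v al l.
  by case/orP: cov => // /covers_atP[]; rewrite ltnNge (ltnW (ltn_trans alr rl)).
have below i : (r <= i)%N -> (i < l)%N -> (v i < v l)%N -> (v i < v al)%N.
  move=> ri il vil; have ali : (al < i)%N by apply: leq_trans ri.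
  have := gap i; rewrite ali il vil /= andbT => /(_ isT); rewrite -leqNgt leq_eqVlt.
  by case/orP => // /eqP/ord_inj/perm_inj E; rewrite E ltnn in ali.
split.
  move=> i j ri ij; have rj := ltn_trans ri ij.
  have [il|il] := eqVneq i l.
    have jl : j != l by rewrite -val_eqE /= -il gtn_eqF.
    by rewrite il wl wD ?nal ?(ltnW rj) //; apply: ltn_trans vl _; rewrite -il incv.
  rewrite wD ?nal ?(ltnW ri) //; have [jl|jl] := eqVneq j l.
    by rewrite jl wl below ?(ltnW ri) -?jl // incv.
  by rewrite wD ?nal ?(ltnW rj) // incv.
have rl' : r != l by rewrite -val_eqE /= ltn_eqF.
exists s => //; rewrite (wD r) ?nal //; have [sl|sl] := eqVneq s l.
  by rewrite sl wl below // -sl.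
by rewrite wD ?nal // ltnW.
Qed.

End Step.

End LastDescent.

(** * Induction on the last descent *)

Section Monk.

Local Open Scope ring_scope.

Variables (R : comNzRingType) (x : nat -> R) (n : nat).
Implicit Types (u v : 'S_n) (al r s i j k l : 'I_n).

Lemma bruhat_operatorE (F : 'S_n -> R) al u :
  bruhat_operator F al u =
  \sum_(l | covers_at u al l) F (mul_tperm u al l) -
  \sum_(k | covers_at u k al) F (mul_tperm u k al).
Proof.
rewrite [X in X - _]big_mkcond [X in _ - X]big_mkcond -sumrB /=.
apply: eq_bigr => j _; rewrite /cover_sign (mul_tpermC u j al) mulrBl.
by congr (_ - _); case: covers_at; rewrite ?mul1r ?mul0r.
Qed.

Lemma monk_increasing al u : increasing_from al.+1 u -> ascends_after u al ->
  x al * schubert x u = bruhat_operator (@schubert R x n) al u.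
Proof.
move=> inc /covers_at_exists[l cov].
rewrite bruhat_operatorE (bigD1 l) //= [X in _ + X - _]big1 ?addr0; last first.
  by move=> l' /andP[cov']; rewrite (covers_at_unique inc cov' cov) eqxx.
by rewrite -(transition x inc cov) addrK.
Qed.

Lemma monk (r : nat) u al : increasing_from r u -> ascends_after u al ->
  x al * schubert x u = bruhat_operator (@schubert R x n) al u.
Proof.
elim: r u al => [|r IHr] u al inc asc.
  by apply: monk_increasing => //; apply: increasing_from_leq inc.
case: (ltnP r n) => [rn|nr]; last first.
  by apply: IHr asc => i j ri; have := ltn_ord i; rewrite ltnNge (leq_trans nr ri).
pose ro := Ordinal rn; have [N leN] := ubnP #|descents_at u ro|.
elim: N u leN al inc asc => // N IHN u leN al inc asc.
case: (ltnP al r) => [alr|ral]; last first.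
  by apply: monk_increasing => //; apply: increasing_from_leq inc.
have [d0|[s0 s0P]] := set_0Vmem (descents_at u ro).
  by apply: IHr asc; apply: (@no_descents_increasing n u ro).
case: (@arg_maxnP _ s0 (fun j => j \in descents_at u ro) (fun j : 'I_n => val j) s0P).
move=> s; rewrite inE => /andP[rs us] smax_.
have smax j : (ro < j)%N -> (u j < u ro)%N -> (j <= s)%N.
  move=> rj uj; have jd : j \in descents_at u ro by rewrite inE rj.
  exact: smax_ jd.
set v := mul_tperm u ro s.
have incv : increasing_from r.+1 v by apply: (@step_increasing n u ro s).
(* Valid for any [F], because [u] is the only upper cover of [v] at [r]. It is applied both to
   [schubert] and to its image under [theta_al]. *)
have expand (F : 'S_n -> R) : F u = bruhat_operator F ro v +
    \sum_(k | covers_at v k ro) F (mul_tperm v k ro).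
  rewrite bruhat_operatorE (eq_bigl (pred1 s)) ?big_pred1_eq; last first.
    exact: (@step_covers n u ro s).
  rewrite subrK /v /mul_tperm mulgA tperm2 mul1g //.
have small (w : 'S_n) :
    (forall j, (ro < j)%N -> w j = v j) -> (w ro <= u s)%N ->
    (#|descents_at w ro| < N)%N.
  move=> wv wr; rewrite -ltnS; apply: leq_trans leN.
  by rewrite ltnS; apply: (@step_descents n u ro s).
have vro : v ro = u s by apply: mul_tpermL.
have monk_v : x al * schubert x v = bruhat_operator (@schubert R x n) al v.
  by apply: IHN => //; [apply: small; rewrite ?vro|apply: step_ascends].
have monk_lower k : covers_at v k ro ->
    x al * schubert x (mul_tperm v k ro) =
    bruhat_operator (@schubert R x n) al (mul_tperm v k ro).
  move=> cov; have [kr vkr _] := covers_atP _ _ _ cov.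
  have wj j : (ro < j)%N -> mul_tperm v k ro j = v j.
    move=> rj; apply: mul_tpermD; rewrite -val_eqE /= gtn_eqF //.
    exact: ltn_trans kr rj.
  have incw : increasing_from r.+1 (mul_tperm v k ro).
    by move=> i j ri ij; rewrite !wj ?incv // (ltn_trans ri ij).
  apply: IHN => //; last exact: (@step_lower_ascends n u ro s).
  by apply: small => //; rewrite mul_tpermR ltnW // -vro.
(* After commuting, [theta_r] acts on the terms of [theta_al v], where it is multiplication by
   [x ro]; the induction hypothesis at [v] then gives [x ro * (x al * schubert x v)]. *)
rewrite [RHS]expand bruhat_operatorC.
rewrite -(eq_bigr _ monk_lower).
have -> : bruhat_operator (bruhat_operator (@schubert R x n) ro) al v =
    x ro * (x al * schubert x v).
  rewrite monk_v /bruhat_operator mulr_sumr; apply: eq_bigr => l _.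
  case cov: (covers_at v al l || covers_at v l al); last first.
    move/negbT: cov; rewrite negb_or /cover_sign => /andP[/negPf -> /negPf ->].
    by rewrite subrr !mul0r mulr0.
  have [incw ascw] := @step_commuting_upper n u ro s inc rs us smax al alr l cov.
  by rewrite -/(bruhat_operator _ _ _) -monk_increasing // mulrCA.
have := @monk_increasing ro v incv.
rewrite (expand (@schubert R x n)) => <-.
- by rewrite mulrDr mulr_sumr; congr (_ + _); ring.
- by exists s => //; rewrite vro /v mul_tpermR.
Qed.

End Monk.

(** * Pipe labels of a tiling *)

Section WordEvents.

Lemma subseq2_adjacent (p q : nat) A B : subseq [:: p; q] (A ++ p :: q :: B).
Proof. by apply: subseq_trans (suffix_subseq _ _); rewrite /= !eqxx sub0seq. Qed.

Lemma subseq2_iota (p q n : nat) : p < q -> q < n -> subseq [:: p; q] (iota 0 n).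
Proof.
move=> pq qn; rewrite (iota_split qn) -[[:: p; q]]/([:: p] ++ [:: q]).
by apply: cat_subseq; rewrite sub1seq ?inE ?eqxx ?mem_iota.
Qed.

Variables (n N : nat) (W : nat -> seq nat) (ev : nat -> option (nat * nat)).
Hypothesis W0 : W 0 = iota 0 n.
Hypothesis W_step : forall t, t < N ->
  if ev t is Some (c, b) then
    exists A B, W t = A ++ c :: b :: B /\ W t.+1 = A ++ b :: c :: B
  else W t.+1 = W t.

Lemma word_perm t : t <= N -> perm_eq (W t) (iota 0 n).
Proof.
elim: t => [|t IH] tN; first by rewrite W0.
have := W_step tN; case: (ev t) => [[c b] [A [B [Wt ->]]]|->]; last exact: IH (ltnW tN).
apply: perm_trans (IH (ltnW tN)); rewrite Wt perm_cat2l.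
by rewrite -[b :: c :: B]/([:: b] ++ [:: c] ++ B) perm_catCA.
Qed.

Lemma word_uniq t : t <= N -> uniq (W t).
Proof. by move=> tN; rewrite (perm_uniq (word_perm tN)) iota_uniq. Qed.

Lemma event_labels t c b : t < N -> ev t = Some (c, b) -> [/\ c < n, b < n & c != b].
Proof.
move=> tN E; have := W_step tN; rewrite E => -[A [B [Wt _]]].
have := word_uniq (ltnW tN); rewrite Wt cat_uniq => /and3P[_ _] /=.
rewrite inE negb_or => /andP[/andP[cb _] _].
have memW d : d \in W t -> d < n by rewrite (perm_mem (word_perm (ltnW tN))) mem_iota.
by split=> //; apply: memW; rewrite Wt mem_cat !inE eqxx ?orbT.
Qed.

Lemma order_persists p q t1 t2 : t1 <= t2 -> t2 <= N ->
    (forall t, t1 <= t < t2 -> ev t <> Some (p, q)) ->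
  subseq [:: p; q] (W t1) -> subseq [:: p; q] (W t2).
Proof.
elim: t2 => [|t2 IH]; first by rewrite leqn0 => /eqP ->.
rewrite leq_eqVlt => /orP[/eqP <- //|]; rewrite ltnS => t12 t2N noev sW1.
have {IH} sW : subseq [:: p; q] (W t2).
  apply: IH => //; first exact: ltnW.
  by move=> t /andP[t1t tt2]; apply: noev; rewrite t1t ltnW.
have := W_step t2N; case E: (ev t2) => [[c b]|]; last by move=> ->.
case=> A [B [Wt ->]]; rewrite Wt in sW; apply: subseq2_swap sW.
apply/negP => /andP[/eqP cp /eqP bq]; apply: (noev t2); first by rewrite t12 ltnSn.
by rewrite E cp bq.
Qed.

(** After an ascending exchange the larger label is on the left, and only a descending exchange
    could undo this. *)
Lemma ascending_events_cross_once :
    (forall t c b, t < N -> ev t = Some (c, b) -> c < b) ->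
  forall t1 t2 c b, t1 < t2 -> t2 < N ->
    ev t1 = Some (c, b) -> ev t2 <> Some (c, b) /\ ev t2 <> Some (b, c).
Proof.
move=> asc t1 t2 c b t12 t2N E1; have t1N := ltn_trans t12 t2N.
have cb := asc _ _ _ t1N E1; split=> E2; last first.
  by have := asc _ _ _ t2N E2; rewrite ltnNge (ltnW cb).
have := W_step t1N; rewrite E1 => -[A [B [_ Wt1]]].
have := W_step t2N; rewrite E2 => -[A' [B' [Wt2 _]]].
apply: (@uniq_subseq2_antisym c b _ (word_uniq (ltnW t2N))).
  by rewrite Wt2 subseq2_adjacent.
apply: (order_persists t12 (ltnW t2N)); last by rewrite Wt1 subseq2_adjacent.
move=> t /andP[_ tt2] E; have := asc _ _ _ (ltn_trans tt2 t2N) E.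
by rewrite ltnNge (ltnW cb).
Qed.

(** The initial word is sorted, so a descending exchange must be preceded by the ascending exchange
    of the same pair: these two pipes would cross twice. *)
Lemma cross_once_ascending_events :
    (forall t1 t2 c b, t1 < t2 -> t2 < N -> ev t1 = Some (c, b) -> ev t2 <> Some (b, c)) ->
  forall t c b, t < N -> ev t = Some (c, b) -> c < b.
Proof.
move=> once t c b tN E; have [cn bn cb] := event_labels tN E.
rewrite ltnNge; apply/negP => bc; have {cb} bc : b < c by rewrite ltn_neqAle eq_sym cb.
have := W_step tN; rewrite E => -[A [B [Wt _]]].
apply: (@uniq_subseq2_antisym b c _ (word_uniq (ltnW tN))); last first.
  by rewrite Wt subseq2_adjacent.
apply: (order_persists (leq0n t) (ltnW tN)); last by rewrite W0 subseq2_iota.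
by move=> t' /andP[_ t't] E'; apply: (once _ _ _ _ t't tN E').
Qed.

End WordEvents.

(** * Propagation of labels through a tiling *)

Definition tile_out (t : tile) (h v : label) : label * label :=
  match t with
  | RTile => (None, v)
  | JTile => (h, None)
  | CrossTile => (v, h)
  | BlankTile => (None, None)
  | HorTile => (None, h)
  | VertTile => (v, None)
  end.

Lemma meetsE t e : meets t e =
  match t, e with
  | RTile, (South | East) | JTile, (West | North) | CrossTile, _
  | HorTile, (West | East) | VertTile, (South | North) => true
  | _, _ => false
  end.
Proof.
have E (a b : edge) : (a == b) = (edge_code a == edge_code b :> nat).
  by rewrite -(inj_eq (can_inj edge_codeK)).
by case: t; case: e; rewrite /meets /= ?E /edge_code /= ?inordK.
Qed.

Definition tile_fits (t : tile) (h v : label) : bool :=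
  (meets t West == isSome h) && (meets t South == isSome v).

Definition tile_ok (t : tile) (h v : label) : bool :=
  tile_fits t h v &&
  (if h is Some c then if v is Some b then c < b else true else true).

Lemma tile_fits_out t h v : tile_fits t h v ->
  isSome (tile_out t h v).1 = meets t North /\ isSome (tile_out t h v).2 = meets t East.
Proof. by rewrite /tile_fits !meetsE; case: t; case: h => [?|]; case: v => [?|]. Qed.

Definition label_into (h v : label) (e : edge) : label :=
  match e with South => v | West => h | _ => None end.

Definition label_out_of (o : label * label) (e : edge) : label :=
  match e with North => o.1 | East => o.2 | _ => None end.

Lemma label_along_segment t h v s : s \in segments t ->
  label_out_of (tile_out t h v) s.2 = label_into h v s.1.
Proof. by case: t; rewrite /= ?inE //; [| |case/orP| |]; move=> /eqP ->. Qed.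

Section FunctionalLabels.

Variable n : nat.
Variable f : nat -> nat -> tile.

Fixpoint row_label (row : nat -> tile) (st : nat -> label) j : label :=
  if j is j'.+1 then (tile_out (row j') (row_label row st j') (st j')).2 else None.

(* Row k is the k-th row counted from the bottom of the grid. *)
Fixpoint column_label k : nat -> label :=
  if k is k'.+1 then
    fun j => (tile_out (f k' j) (row_label (f k') (column_label k') j) (column_label k' j)).1
  else Some.

Definition edge_label k j := row_label (f k) (column_label k) j.

Definition all_fit_row k := forall j, j < n ->
  tile_fits (f k j) (edge_label k j) (column_label k j).

Definition all_fit := forall k j, k < n -> j < n ->
  tile_fits (f k j) (edge_label k j) (column_label k j).

(** The boundary word at tile [(k, j)] followed by the labels that have already left, the latest
    first. Keeping those makes every word a rearrangement of all [n] labels, and passing to the next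
    row changes nothing. *)
Definition frontier k j : seq nat :=
  labels ([seq column_label k.+1 j' | j' <- iota 0 j] ++
    edge_label k j :: [seq column_label k j' | j' <- iota j (n - j)] ++
    [seq edge_label k' n | k' <- rev (iota 0 k)]).

Definition event k j : option (nat * nat) :=
  if f k j is CrossTile then
    if edge_label k j is Some c then
      if column_label k j is Some b then Some (c, b) else None
    else None
  else None.

Lemma frontier_step k j : all_fit -> k < n -> j < n ->
  if event k j is Some (c, b) then
    exists A B, frontier k j = A ++ c :: b :: B /\ frontier k j.+1 = A ++ b :: c :: B
  else frontier k j.+1 = frontier k j.
Proof.
move=> fit kn jn; have := fit k j kn jn; rewrite /tile_fits !meetsE /frontier.
have -> : iota 0 j.+1 = iota 0 j ++ [:: j] by rewrite -[in LHS]addn1 iotaD.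
have -> : n - j = (n - j.+1).+1 by lia.
rewrite map_cat -catA /= !labels_cat.
rewrite -/(edge_label k j) [edge_label k j.+1]/edge_label /= -/(edge_label k j).
rewrite /event; set A := labels [seq _ | _ <- iota 0 j].
set B := labels (_ ++ _).
case: (f k j); case: (edge_label k j) => [c|]; case: (column_label k j) => [b|] //= _.
by exists A, B.
Qed.

Lemma frontier_next k : frontier k.+1 0 = frontier k n.
Proof.
rewrite /frontier subnn subn0 /= -[0 :: iota 1 k]/(iota 0 k.+1).
by rewrite -addn1 iotaD add0n rev_cat /= !labels_cat.
Qed.

Lemma frontier0 : frontier 0 0 = iota 0 n.
Proof. by rewrite /frontier subn0 /= cats0; apply: labels_map_Some. Qed.

(** Numbering the tiles in scan order turns the frontiers into a single sequence, as required by the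
    lemmas on words and events. *)
Definition timed_word t := frontier (t %/ n) (t %% n).
Definition timed_event t := event (t %/ n) (t %% n).

Lemma timed_step : all_fit -> forall t, t < n * n ->
  if timed_event t is Some (c, b) then
    exists A B, timed_word t = A ++ c :: b :: B /\ timed_word t.+1 = A ++ b :: c :: B
  else timed_word t.+1 = timed_word t.
Proof.
move=> fit t tn; have n0 : 0 < n by case: (n) tn.
have kn : t %/ n < n by rewrite ltn_divLR.
have jn : t %% n < n by rewrite ltn_mod.
suff E : timed_word t.+1 = frontier (t %/ n) (t %% n).+1.
  by rewrite E; apply: frontier_step.
rewrite /timed_word; have [jn'|jn'] := eqVneq (t %% n).+1 n.
  have Et : t.+1 = (t %/ n).+1 * n by rewrite {1}(divn_eq t n) -addnS jn' mulSn addnC.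
  by rewrite Et mulnK // modnMl frontier_next jn'.
have jn2 : (t %% n).+1 < n by rewrite ltn_neqAle jn'.
have Et : t.+1 = t %/ n * n + (t %% n).+1 by rewrite {1}(divn_eq t n) addnS.
have -> : t.+1 %/ n = t %/ n by rewrite [in LHS]Et divnMDl // (divn_small jn2) addn0.
by have -> : t.+1 %% n = (t %% n).+1 by rewrite [in LHS]Et modnMDl (modn_small jn2).
Qed.

Lemma timed_word0 : 0 < n -> timed_word 0 = iota 0 n.
Proof. by move=> n0; rewrite /timed_word div0n mod0n frontier0. Qed.

End FunctionalLabels.

(** * Labels agree with pipes defined by connectivity *)

Section LabelledDiagram.

Variables (n : nat) (D : 'M[tile]_n).
Implicit Types (i j k p q : 'I_n).

Definition tile_at (k j : nat) : tile :=
  if insub k is Some k' then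
    if insub j is Some j' then D (rev_ord (k' : 'I_n)) (j' : 'I_n) else BlankTile
  else BlankTile.

Lemma tile_atE k j : tile_at k j = D (rev_ord k) j.
Proof. by rewrite /tile_at !valK. Qed.

Local Notation col := (column_label tile_at).
Local Notation row := (edge_label tile_at).

Lemma pipe_tilingP : reflect
  [/\ [/\ forall i j j', j.+1 = j' :> nat -> meets (D i j) East = meets (D i j') West,
          forall i i' j, i.+1 = i' :> nat -> meets (D i j) South = meets (D i' j) North
        & forall i j, i = 0 :> nat -> meets (D i j) North = false],
      forall i j, j = 0 :> nat -> meets (D i j) West = false,
      forall i j, i.+1 = n -> meets (D i j) South
    & forall i j, j.+1 = n -> meets (D i j) East]
  (pipe_tiling D).
Proof.
apply: (iffP and5P) => [[/forallP H1 /forallP H2 /forallP H3 /forallP H4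
    /andP[/forallP H5 /forallP H6]]|[[H1 H2 H3] H4 H5 H6]].
  split; first split.
  - by move=> i j j' E; have /forallP/(_ j)/forallP/(_ j') := H1 i; rewrite E eqxx => /eqP.
  - by move=> i i' j E; have /forallP/(_ i')/forallP/(_ j) := H2 i; rewrite E eqxx => /eqP.
  - by move=> i j E; have /forallP/(_ j) := H3 i; rewrite E => /negPf.
  - by move=> i j E; have /forallP/(_ j) := H4 i; rewrite E => /negPf.
  - by move=> i j E; have /forallP/(_ j) := H5 i; rewrite E eqxx.
  - by move=> i j E; have /forallP/(_ j) := H6 i; rewrite E eqxx.
split; last (apply/andP; split); apply/forallP => i; apply/forallP => j.
- by apply/forallP => j'; apply/implyP => /eqP E; apply/eqP; apply: H1.
- by apply/forallP => j'; apply/implyP => /eqP E; apply/eqP; apply: H2.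
- by apply/implyP => /eqP E; rewrite H3.
- by apply/implyP => /eqP E; rewrite H4.
- by apply/implyP => /eqP E; rewrite H5.
- by apply/implyP => /eqP E; rewrite H6.
Qed.

Lemma rev_ord_top k : k.+1 = n -> rev_ord k = 0 :> nat.
Proof. by move=> kn /=; rewrite kn subnn. Qed.

Lemma col_next k j : col k.+1 j = (tile_out (D (rev_ord k) j) (row k j) (col k j)).1.
Proof. by rewrite -tile_atE. Qed.

Lemma row_next k j : row k j.+1 = (tile_out (D (rev_ord k) j) (row k j) (col k j)).2.
Proof. by rewrite -tile_atE. Qed.

Lemma tile_at_nat (k j : nat) (kn : k < n) (jn : j < n) :
  tile_at k j = D (rev_ord (Ordinal kn)) (Ordinal jn).
Proof. exact: tile_atE (Ordinal kn) (Ordinal jn). Qed.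

Lemma pipe_tiling_fit : pipe_tiling D -> all_fit n tile_at.
Proof.
case/pipe_tilingP=> -[Heast Hsouth _] Hwest0 Hsouth0 _.
have He (k j : nat) : k < n -> j.+1 < n ->
    meets (tile_at k j) East = meets (tile_at k j.+1) West.
  by move=> kn jn; rewrite (tile_at_nat kn jn) (tile_at_nat kn (ltnW jn)); apply: Heast.
have Hs (k j : nat) : k.+1 < n -> j < n ->
    meets (tile_at k.+1 j) South = meets (tile_at k j) North.
  move=> kn jn; rewrite (tile_at_nat kn jn) (tile_at_nat (ltnW kn) jn).
  by apply: Hsouth; rewrite /= subnSK.
have west (k : nat) : k < n ->
    (forall j : nat, j < n -> meets (tile_at k j) South = isSome (col k j)) ->
    all_fit_row n tile_at k.
  move=> kn S; elim=> [|j IHj] jn; rewrite /tile_fits S // eqxx andbT.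
    by rewrite (tile_at_nat kn jn) Hwest0.
  rewrite [row k j.+1]/edge_label [row_label _ _ _]/= -/(row k j).
  by rewrite (tile_fits_out (IHj (ltnW jn))).2 He.
suff S (k : nat) : k < n ->
    forall j : nat, j < n -> meets (tile_at k j) South = isSome (col k j).
  by move=> k j kn; apply: west (S k kn) j.
elim: k => [|k IH] kn j jn; first by rewrite (tile_at_nat kn jn) Hsouth0 //= subn1 prednK.
rewrite Hs // [col k.+1 j]/= -/(row k j).
by rewrite (tile_fits_out (west k (ltnW kn) (IH (ltnW kn)) j jn)).1.
Qed.

Lemma fit_pipe_tiling : all_fit n tile_at ->
    (forall j : 'I_n, col n j = None) -> (forall k : 'I_n, isSome (row k n)) ->
  pipe_tiling D.
Proof.
move=> fit top right.
have fitD k j : tile_fits (D (rev_ord k) j) (row k j) (col k j).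
  by rewrite -tile_atE; apply: fit.
have fitR i j : tile_fits (D i j) (row (rev_ord i) j) (col (rev_ord i) j).
  by rewrite -{1}(rev_ordK i).
have west i j : meets (D i j) West = isSome (row (rev_ord i) j).
  by have /andP[/eqP] := fitR i j.
have south i j : meets (D i j) South = isSome (col (rev_ord i) j).
  by have /andP[_ /eqP] := fitR i j.
have north i j : meets (D i j) North = isSome (col (rev_ord i).+1 j).
  by rewrite col_next rev_ordK (tile_fits_out (fitR i j)).1.
have east i j : meets (D i j) East = isSome (row (rev_ord i) j.+1).
  by rewrite row_next rev_ordK (tile_fits_out (fitR i j)).2.
apply/pipe_tilingP; split; first split.
- by move=> i j j' E; rewrite east west E.
- move=> i i' j E; rewrite south north.
  by have -> : (rev_ord i').+1 = rev_ord i by rewrite /= subnSK // E.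
- move=> i j E; rewrite north.
  have -> : (rev_ord i).+1 = n by rewrite /= subnSK // E subn0.
  by rewrite top.
- by move=> i j E; rewrite west E.
- by move=> i j E; rewrite south /= E subnn.
- by move=> i j E; rewrite east E right.
Qed.

Definition label_in (x : passage n) : label :=
  let: (i, j, (e, _)) := x in label_into (row (rev_ord i) j) (col (rev_ord i) j) e.

Lemma label_next x y : next_passage D x y -> label_in y = label_in x.
Proof.
case: x => [[i j] [e o]]; case: y => [[i' j'] [e' o']] /=.
case/and3P=> /(@label_along_segment _ (row (rev_ord i) j) (col (rev_ord i) j)) /= <- _.
case/orP=> /and4P[/eqP -> /eqP -> /eqP E1 /eqP E2] /=.
  have -> : n - i'.+1 = (rev_ord i).+1 by rewrite E1 /= subnSK.
  by rewrite E2 col_next rev_ordK.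
by rewrite E1 -E2 -[n - i.+1]/(nat_of_ord (rev_ord i)) row_next rev_ordK.
Qed.

Lemma pipe_through_label p x : pipe_through D p x -> is_passage D x /\ label_in x = Some (p : nat).
Proof.
case/existsP=> i0 /existsP[o /and3P[/eqP i0n pass0 /connectP[w]]].
elim/last_ind: w x => [|w y IH] x /=.
  by move=> _ ->; split=> //=; rewrite i0n subnn.
rewrite rcons_path last_rcons => /andP[pw nxt] ->.
have [_ E] := IH _ pw erefl; split; last by rewrite (label_next nxt).
by move: nxt; case: (last _ _) => [[i j] [e o1]]; case: (y) => [[? ?] [? ?]] /and3P[].
Qed.

Lemma pipe_through_next p x y :
  pipe_through D p x -> next_passage D x y -> pipe_through D p y.
Proof.
case/existsP=> i0 /existsP[o /and3P[i0n pass0 conn]] nxt.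
apply/existsP; exists i0; apply/existsP; exists o; rewrite i0n pass0 /=.
exact: connect_trans conn (connect1 nxt).
Qed.

Lemma tile_out_north t h v (p : nat) : (tile_out t h v).1 = Some p ->
  exists2 e, (e, North) \in segments t & label_into h v e = Some p.
Proof.
by case: t => //= E; [exists West|exists South|exists South]; rewrite // !inE eqxx.
Qed.

Lemma tile_out_east t h v (p : nat) : (tile_out t h v).2 = Some p ->
  exists2 e, (e, East) \in segments t & label_into h v e = Some p.
Proof.
by case: t => //= E; [exists South|exists West|exists West]; rewrite // !inE eqxx ?orbT.
Qed.

(** The label is traced backwards: a segment is fed by the tile below or by the one to the left,
    both earlier in scan order, until the south edge, where labels are column numbers. *)
Lemma label_pipe_through p x : is_passage D x -> label_in x = Some (p : nat) ->
  pipe_through D p x.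
Proof.
(* Segments entering from the south are treated once, with the result for the row below as a
   hypothesis. *)
have vertical (k j : nat) (kn : k < n) (jn : j < n) o :
    (forall (k' : nat) (kn' : k' < n) s, k = k'.+1 ->
      s \in segments (D (rev_ord (Ordinal kn')) (Ordinal jn)) ->
      label_into (row k' j) (col k' j) s.1 = Some (p : nat) ->
      pipe_through D p (rev_ord (Ordinal kn'), Ordinal jn, s)) ->
    (South, o) \in segments (D (rev_ord (Ordinal kn)) (Ordinal jn)) ->
    col k j = Some (p : nat) ->
    pipe_through D p (rev_ord (Ordinal kn), Ordinal jn, (South, o)).
  case: k kn => [|k] kn below pass.
    case=> jp; have Ej : Ordinal jn = p by apply: val_inj.
    apply/existsP; exists (rev_ord (Ordinal kn)); apply/existsP; exists o.
    by rewrite -Ej connect0 /= pass subnSK // subn0 eqxx.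
  have kn' := ltnW kn; move=> lab.
  have := @col_next (Ordinal kn') (Ordinal jn); rewrite [LHS]lab => /esym/tile_out_north.
  case=> e pass' lab'; apply: (@pipe_through_next _ (rev_ord (Ordinal kn'), Ordinal jn, (e, North))).
    exact: below.
  by rewrite /= pass pass' !eqxx subnSK // eqxx.
suff H (k j : nat) (kn : k < n) (jn : j < n) s :
    s \in segments (D (rev_ord (Ordinal kn)) (Ordinal jn)) ->
    label_into (row k j) (col k j) s.1 = Some (p : nat) ->
    pipe_through D p (rev_ord (Ordinal kn), Ordinal jn, s).
  case: x => [[i j] s] /= pass lab.
  have E : rev_ord (Ordinal (ltn_ord (rev_ord i))) = i.
    by rewrite -[RHS]rev_ordK; congr rev_ord; apply: val_inj.
  have Ej : Ordinal (ltn_ord j) = j by apply: val_inj.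
  have := H _ _ (ltn_ord (rev_ord i)) (ltn_ord j) s.
  by rewrite E Ej => /(_ pass); apply; case: (s) lab.
elim: k j kn jn s => [|k IHk]; elim=> [|j IHj] kn jn [e o] pass lab.
all: case: e pass lab => //= pass lab.
1,2: by apply: (vertical _ _ kn jn o _ pass lab).
2,3: apply: (vertical _ _ kn jn o _ pass lab) => k' kn' s [E]; subst k'; exact: IHk.
all: have jn' := ltnW jn.
all: have := @row_next (Ordinal kn) (Ordinal jn'); rewrite [LHS]lab => /esym/tile_out_east.
all: case=> e pass' lab'; apply: (@pipe_through_next _ (rev_ord (Ordinal kn), Ordinal jn', (e, East)));
  [exact: IHj|by rewrite /= pass pass' !eqxx orbT].
Qed.

Lemma pipe_throughE p x :
  pipe_through D p x = is_passage D x && (label_in x == Some (p : nat)).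
Proof.
apply/idP/andP => [/pipe_through_label[-> ->]|[pass /eqP lab]]; first by rewrite eqxx.
exact: label_pipe_through.
Qed.

Lemma pipe_exitsE p i : pipe_exits D p i = (row (rev_ord i) n == Some (p : nat)).
Proof.
apply/existsP/eqP => [[j0 /existsP[e /andP[/eqP j0n]]]|lab].
  rewrite pipe_throughE => /andP[pass /eqP lab].
  have := label_along_segment (row (rev_ord i) j0) (col (rev_ord i) j0) pass.
  have := @row_next (rev_ord i) j0; rewrite j0n rev_ordK => -> /= ->.
  exact: lab.
have n0 : 0 < n by apply: leq_ltn_trans (ltn_ord i).
have jn : n.-1 < n by rewrite prednK.
have := @row_next (rev_ord i) (Ordinal jn); rewrite /= prednK // lab rev_ordK.
move=> /esym/tile_out_east[e pass lab'].
exists (Ordinal jn); apply/existsP; exists e; rewrite /= prednK // eqxx pipe_throughE /=.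
by rewrite pass /= lab'.
Qed.

Lemma mem_crossings p q c : (c \in crossings D p q) =
  (event tile_at (rev_ord c.1) c.2 \in
    [:: Some (p : nat, q : nat); Some (q : nat, p : nat)]).
Proof.
case: c => i j; rewrite inE !pipe_throughE /event.
have -> : tile_at (rev_ord (i, j).1) (i, j).2 = D i j by rewrite tile_atE rev_ordK.
rewrite /= !inE; have [->|] := eqVneq (D i j) CrossTile; last first.
  by case: (D i j) => //; rewrite eqxx.
rewrite !inE !eqxx orbT /=.
case: (row _ _) => [c|]; case: (col _ _) => [b|]; rewrite /= ?andbF //.
rewrite !(inj_eq (@Some_inj _)) !xpair_eqE orbC.
by rewrite ![(c == _) && _]andbC.
Qed.

End LabelledDiagram.

Section LabelledBPD.

Variables (n : nat) (D : 'M[tile]_n).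
Implicit Types (i j k p q : 'I_n).

Local Notation col := (column_label (tile_at D)).
Local Notation row := (edge_label (tile_at D)).

Definition passage_time (c : 'I_n * 'I_n) : nat := rev_ord c.1 * n + c.2.

Lemma passage_timeK c :
  passage_time c %/ n = rev_ord c.1 /\ passage_time c %% n = c.2.
Proof.
have n0 : 0 < n := leq_ltn_trans (leq0n _) (ltn_ord c.2).
by rewrite /passage_time divnMDl // modnMDl divn_small // modn_small // addn0.
Qed.

Lemma passage_time_lt c : passage_time c < n * n.
Proof.
have c2 := ltn_ord c.2; apply: (@leq_trans ((rev_ord c.1).+1 * n)).
  by rewrite /passage_time mulSn addnC ltn_add2r.
by rewrite leq_mul2r ltn_ord orbT.
Qed.

Lemma passage_time_inj : injective passage_time.
Proof.
move=> [i j] [i' j'] E; have := passage_timeK (i, j); rewrite E.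
have [-> ->] := passage_timeK (i', j') => -[E1 E2].
by congr (_, _); [apply: rev_ord_inj|]; apply: val_inj.
Qed.

Lemma timed_event_passage c :
  timed_event n (tile_at D) (passage_time c) = event (tile_at D) (rev_ord c.1) c.2.
Proof. by rewrite /timed_event; have [-> ->] := passage_timeK c. Qed.

Lemma timeP t : t < n * n -> exists c, t = passage_time c.
Proof.
move=> tn; have n0 : 0 < n by case: (n) tn.
have kn : t %/ n < n by rewrite ltn_divLR.
have jn : t %% n < n by rewrite ltn_mod.
exists (rev_ord (Ordinal kn), Ordinal jn).
by rewrite /passage_time rev_ordK /= -divn_eq.
Qed.

(** Cells and times correspond bijectively, so two cells in [crossings D p q] are two exchanges of
    the same pair of letters. *)
Lemma crossings_ascending : all_fit n (tile_at D) ->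
  (forall p q, p != q -> #|crossings D p q| <= 1) <->
  (forall t c b, t < n * n -> timed_event n (tile_at D) t = Some (c, b) -> c < b).
Proof.
move=> fit.
have [n0|n0] := posnP n.
  split=> [_ t c b tn|_ p]; first by exfalso; rewrite n0 in tn.
  by have p0 := leq_ltn_trans (leq0n p) (ltn_ord p); exfalso; rewrite n0 in p0.
have W0 := timed_word0 (tile_at D) n0.
have Ws := timed_step fit.
split=> [once|asc p q pq].
  apply: (cross_once_ascending_events W0 Ws) => t1 t2 c b t12 t2N E1 E2.
  have [cn bn cb] := event_labels W0 Ws (ltn_trans t12 t2N) E1.
  have [c1 T1] := timeP (ltn_trans t12 t2N); have [c2 T2] := timeP t2N.
  have /card_le1_eqP H := once (Ordinal cn) (Ordinal bn) cb.
  have c12 : c1 = c2.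
    apply: H; rewrite mem_crossings -timed_event_passage -?T1 -?T2 ?E1 ?E2 !inE eqxx //.
    by rewrite orbT.
  by rewrite T1 T2 c12 ltnn in t12.
apply/card_le1_eqP => c1 c2; rewrite !mem_crossings -!timed_event_passage => M1 M2.
wlog lt12 : c1 c2 M1 M2 / passage_time c1 < passage_time c2.
  move=> H; case: (ltngtP (passage_time c1) (passage_time c2)) => [|/H E|/passage_time_inj //].
    exact: H.
  by rewrite E.
have once := ascending_events_cross_once W0 Ws asc lt12 (passage_time_lt c2).
by move: M1 M2; rewrite !inE => /orP[] /eqP /once[N1 N2] /orP[] /eqP.
Qed.

Lemma tile_fits_cross t (c b : nat) : tile_fits t (Some c) (Some b) -> t = CrossTile.
Proof. by rewrite /tile_fits !meetsE; case: t. Qed.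

(** Replaces the global conditions on pipes by a local condition at each tile and boundary values,
    which is what a transfer computation can sum over. *)
Lemma labelled_bpdP (w : 'S_n) : reflect
  [/\ forall k j, tile_ok (tile_at D k j) (row k j) (col k j),
      forall k, row k n = Some (w (rev_ord k) : nat)
    & forall j, col n j = None]
  (is_bpd D && has_perm D w).
Proof.
have permE : reflect (forall k, row k n = Some (w (rev_ord k) : nat)) (has_perm D w).
  apply: (iffP forallP) => [H k|H i]; last by rewrite pipe_exitsE H rev_ordK.
  by have := H (rev_ord k); rewrite pipe_exitsE rev_ordK => /eqP.
apply: (iffP idP) => [/andP[/andP[til once] /permE exits]|[ok exits top]].
  have fit := pipe_tiling_fit til; split=> // [k j|j].
    rewrite /tile_ok fit //=.
    case Er: (row k j) => [c|] //; case Ec: (col k j) => [b|] //.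
    have Ecross : tile_at D k j = CrossTile.
      by apply: (@tile_fits_cross _ c b); rewrite -Er -Ec fit.
    apply: (crossings_ascending fit).1 (passage_time (rev_ord k, j)) _ _ (passage_time_lt _) _.
      by move=> p q pq; move/forallP/(_ p)/forallP/(_ q)/implyP: once; apply.
    by rewrite timed_event_passage rev_ordK /event /= Ecross Er Ec.
  have n0 : 0 < n := leq_ltn_trans (leq0n _) (ltn_ord j).
  have kn : n.-1 < n by rewrite prednK.
  have [[_ _ /(_ (rev_ord (Ordinal kn)) j) H] _ _ _] := pipe_tilingP _ til.
  have fitk : tile_fits (D (rev_ord (Ordinal kn)) j) (row n.-1 j) (col n.-1 j).
    by rewrite -tile_atE; apply: fit.
  have En : (Ordinal kn).+1 = n by rewrite /= prednK.
  have := col_next D (Ordinal kn) j; rewrite En => E.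
  have := (tile_fits_out fitk).1; rewrite -E H ?rev_ord_top //.
  by case: (col n j).
have fit : all_fit n (tile_at D).
  by move=> k j kn jn; have /andP[] := ok (Ordinal kn) (Ordinal jn).
apply/andP; split; last exact/permE.
apply/andP; split; first by apply: fit_pipe_tiling => // k; rewrite exits.
apply/forallP => p; apply/forallP => q; apply/implyP; move: p q.
apply/(crossings_ascending fit) => t c b /timeP[[i j] ->].
rewrite timed_event_passage /event /=.
have /andP[_] := ok (rev_ord i) j; rewrite /=.
case: (tile_at _ _ _) => //; case: (edge_label _ _ _) => [c'|] //.
by case: (column_label _ _ _) => [b'|] // cb [<- <-].
Qed.

End LabelledBPD.

(** * The generating function of bumpless pipe dreams *)

Section WordsOver.

Variable T : eqType.
Implicit Type s : seq T.

Fixpoint words_over s m : seq (seq T) :=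
  if m is m'.+1 then [seq t :: ts | t <- s, ts <- words_over s m'] else [:: [::]].

Lemma words_overS s m :
  words_over s m.+1 = [seq t :: ts | t <- s, ts <- words_over s m].
Proof. by []. Qed.

Lemma mem_words_over s m ts :
  (ts \in words_over s m) = (size ts == m) && all (mem s) ts.
Proof.
elim: m ts => [|m IH] [|t ts] //=.
  by apply/allpairsP => -[[t' ts'] [_ _]].
rewrite eqSS; apply/allpairsP/and3P => [[[t' ts'] /= [ts1 ts2 [-> ->]]]|[sz ts1 ts2]].
  by move: ts2; rewrite IH => /andP[].
by exists (t, ts) => /=; rewrite IH sz.
Qed.

Lemma words_over_uniq s m : uniq s -> uniq (words_over s m).
Proof.
move=> us; elim: m => [|m IH] //=.
by apply: allpairs_uniq => // -[t ts] [t' ts'] _ _ /= [-> ->].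
Qed.

End WordsOver.

Definition tiles : seq tile :=
  [:: RTile; JTile; CrossTile; BlankTile; HorTile; VertTile].

Lemma mem_tiles t : t \in tiles.
Proof. by case: t; rewrite !inE eqxx ?orbT. Qed.

Lemma tiles_uniq : uniq tiles.
Proof.
have E (a b : tile) : (a == b) = (tile_code a == tile_code b :> nat).
  by rewrite -(inj_eq (can_inj tile_codeK)).
by rewrite /tiles /= !inE !E /tile_code !inordK.
Qed.

Lemma eq_blankE t : (t == BlankTile) = if t is BlankTile then true else false.
Proof. by case: eqP => [->//|]; case: t. Qed.

Fixpoint row_ok (h : label) (vs : seq label) (ts : seq tile) : bool :=
  match vs, ts with
  | v :: vs', t :: ts' => tile_ok t h v && row_ok (tile_out t h v).2 vs' ts'
  | [::], [::] => true
  | _, _ => false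
  end.

Fixpoint row_exit (h : label) (vs : seq label) (ts : seq tile) : label :=
  match vs, ts with
  | v :: vs', t :: ts' => row_exit (tile_out t h v).2 vs' ts'
  | _, _ => h
  end.

Fixpoint row_top (h : label) (vs : seq label) (ts : seq tile) : seq label :=
  match vs, ts with
  | v :: vs', t :: ts' => (tile_out t h v).1 :: row_top (tile_out t h v).2 vs' ts'
  | _, _ => [::]
  end.

Lemma size_row_top h vs ts : row_ok h vs ts -> size (row_top h vs ts) = size vs.
Proof. by elim: vs h ts => [|v vs IH] h [|t ts] //= /andP[_ /IH ->]. Qed.

Fixpoint board_ok (s : seq label) (rows : seq (seq tile)) (E : seq nat) : bool :=
  match rows, E with
  | r :: rows', e :: E' => [&& row_ok None s r, row_exit None s r == Some e
                             & board_ok (row_top None s r) rows' E']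
  | [::], [::] => all (pred1 None) s
  | _, _ => false
  end.

Section SumOverBoards.

Local Open Scope ring_scope.

Variables (R : comNzRingType) (x : nat -> R).

Lemma row_transfer_cons (y : R) K acc h v vs :
  row_transfer y K acc h (v :: vs) =
  \sum_(t <- tiles | tile_ok t h v)
     y ^+ (t == BlankTile) *
     row_transfer y K (rcons acc (tile_out t h v).1) (tile_out t h v).2 vs.
Proof.
rewrite /tiles !big_cons big_nil !eq_blankE /tile_ok /tile_fits !meetsE.
by case: h => [c|]; case: v => [b|]; rewrite /= ?expr0 ?expr1 ?mul1r ?addr0 //; case: ifP.
Qed.

Lemma row_transfer_sum_rows (y : R) K acc h vs :
  row_transfer y K acc h vs =
  \sum_(ts <- words_over tiles (size vs) | row_ok h vs ts)
     y ^+ count_mem BlankTile ts * K (acc ++ row_top h vs ts) (row_exit h vs ts).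
Proof.
elim: vs acc h => [|v vs IH] acc h.
  by rewrite big_cons big_nil /= cats0 expr0 mul1r addr0.
rewrite row_transfer_cons [size _]/= words_overS [RHS]big_mkcond big_allpairs_dep.
rewrite [LHS]big_mkcond.
apply: eq_bigr => t _; case: ifP => ok_t; last by rewrite big1 // => ts _; rewrite /= ok_t.
rewrite IH mulr_sumr [LHS]big_mkcond; apply: eq_bigr => ts _; rewrite /= ok_t /=.
by case: ifP => // _; rewrite cat_rcons exprD mulrA.
Qed.

Fixpoint board_weight (rows : seq (seq tile)) : R :=
  if rows is r :: rows' then
    x (size rows') ^+ count_mem BlankTile r * board_weight rows'
  else 1.

Lemma boards_sumE E s :
  boards_sum x E s =
  \sum_(rows <- words_over (words_over tiles (size s)) (size E) | board_ok s rows E)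
     board_weight rows.
Proof.
elim: E s => [|e E IH] s; first by rewrite big_cons big_nil /= ; case: all; rewrite ?addr0.
rewrite boards_sum_cons row_transfer_sum_rows [size (e :: E)]/= words_overS.
rewrite [RHS]big_mkcond big_allpairs_dep.
rewrite [LHS]big_mkcond; apply: eq_bigr => r _.
case: ifP => ok_r; last by rewrite big1 // => rows _; rewrite /= ok_r.
rewrite /next_rows cat0s; case: ifP => ex; last first.
  by rewrite mulr0 big1 // => rows _; rewrite /= ok_r ex.
rewrite IH size_row_top // mulr_sumr [LHS]big_mkcond big_seq [RHS]big_seq.
apply: eq_bigr => rows; rewrite mem_words_over => /andP[/eqP sz _].
by rewrite /= ok_r ex sz.
Qed.

Lemma board_weightE rows :
  board_weight rows = \prod_(k < size rows)
    x (size rows - k.+1)%N ^+ count_mem BlankTile (nth [::] rows k).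
Proof.
elim: rows => [|r rows IH]; first by rewrite big_ord0.
rewrite big_ord_recl /= subn1 /= IH; congr (_ * _).
Qed.

End SumOverBoards.

Section BoardOfDiagram.

Variable n : nat.
Implicit Types (D : 'M[tile]_n) (w : 'S_n).

Definition board D : seq (seq tile) :=
  [seq [seq D (rev_ord k) j | j <- enum 'I_n] | k <- enum 'I_n].

Lemma boardE D :
  board D = [seq [seq tile_at D k j | j <- iota 0 n] | k <- iota 0 n].
Proof.
rewrite /board -val_enum_ord -map_comp; apply: eq_map => k /=.
by rewrite -map_comp; apply: eq_map => j /=; rewrite tile_atE.
Qed.

(** Links the recursion on lists with labels indexed by coordinates; the starting column [j0] is
    arbitrary for the sake of the induction. *)
Lemma row_run (rw : nat -> tile) st (j0 m : nat) :
  let js := iota j0 m in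
  [/\ row_ok (row_label rw st j0) (map st js) (map rw js) =
        all (fun j => tile_ok (rw j) (row_label rw st j) (st j)) js,
      row_exit (row_label rw st j0) (map st js) (map rw js) = row_label rw st (j0 + m)
    & row_top (row_label rw st j0) (map st js) (map rw js) =
        [seq (tile_out (rw j) (row_label rw st j) (st j)).1 | j <- js]].
Proof.
elim: m j0 => [|m IH] j0; first by rewrite addn0.
have [E1 E2 E3] := IH j0.+1; rewrite -addSnnS -E2 /= -E1 -E3.
by split.
Qed.

Lemma board_run (f : nat -> nat -> tile) (k0 m : nat) (E : seq nat) :
  board_ok [seq column_label f k0 j | j <- iota 0 n]
    [seq [seq f k j | j <- iota 0 n] | k <- iota k0 m] E =
  [&& all (fun k => all (fun j => tile_ok (f k j) (edge_label f k j)
                                    (column_label f k j)) (iota 0 n)) (iota k0 m),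
      [seq edge_label f k n | k <- iota k0 m] == map Some E
    & all (fun j => column_label f (k0 + m) j == None) (iota 0 n)].
Proof.
elim: m k0 E => [|m IH] k0 [|e E] //=; first by rewrite all_map addn0.
  by rewrite andbF.
have [/= -> -> ->] := row_run (f k0) (column_label f k0) 0 n.
rewrite add0n -/(edge_label f k0 n) (IH k0.+1) addSnnS eqseq_cons.
by rewrite -!andbA; do !bool_congr.
Qed.

Lemma rev_perm_word w : rev (perm_word w) = [seq (w (rev_ord k) : nat) | k <- enum 'I_n].
Proof.
rewrite /perm_word -map_rev.
have -> : rev (enum 'I_n) = map (@rev_ord n) (enum 'I_n).
  apply: (inj_map val_inj); rewrite map_rev val_enum_ord -map_comp.
  rewrite (@eq_map _ _ _ ((fun k => n - k.+1) \o val)) // map_comp val_enum_ord.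
  apply: (@eq_from_nth _ 0); first by rewrite size_rev size_map.
  move=> k; rewrite size_rev size_iota => kn.
  rewrite nth_rev ?size_iota // (nth_map 0) ?size_iota // !nth_iota //; lia.
by rewrite -map_comp.
Qed.

Lemma board_okE D w :
  board_ok (map Some (iota 0 n)) (board D) (rev (perm_word w)) =
  is_bpd D && has_perm D w.
Proof.
rewrite boardE (board_run (tile_at D) 0) rev_perm_word -map_comp.
apply/and3P/labelled_bpdP => [[ok ex top]|[ok ex top]]; split.
- move=> k j; have /allP/(_ (val k)) := ok; rewrite mem_iota ltn_ord => /(_ isT).
  by move=> /allP/(_ (val j)); rewrite mem_iota ltn_ord => /(_ isT).
- move=> k; move/eqP: ex; rewrite -val_enum_ord -map_comp => /eq_in_map/(_ k).
  by rewrite mem_enum => /(_ isT).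
- by move=> j; have /allP/(_ (val j)) := top; rewrite mem_iota ltn_ord => /(_ isT)/eqP.
- apply/allP => k; rewrite mem_iota => kn; apply/allP => j; rewrite mem_iota => jn.
  exact: ok (Ordinal kn) (Ordinal jn).
- by apply/eqP; rewrite -val_enum_ord -map_comp; apply: eq_map => k /=; rewrite ex.
- by apply/allP => j; rewrite mem_iota => jn; apply/eqP; apply: top (Ordinal jn).
Qed.

Lemma board_inj : injective board.
Proof.
move=> D D' E; apply/matrixP => i j.
have nth_board D0 : nth BlankTile (nth [::] (board D0) (rev_ord i)) j = D0 i j.
  rewrite (nth_map i) ?size_enum_ord // nth_ord_enum.
  by rewrite (nth_map j) ?size_enum_ord // nth_ord_enum rev_ordK.
by rewrite -nth_board E nth_board.
Qed.

Lemma board_surj b : b \in words_over (words_over tiles n) n -> exists D, b = board D.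
Proof.
rewrite mem_words_over => /andP[/eqP sz /allP rows].
exists (\matrix_(i, j) nth BlankTile (nth [::] b (rev_ord i)) j)%R.
apply: (@eq_from_nth _ [::]); first by rewrite size_map size_enum_ord.
rewrite sz => k kn; have k0 := Ordinal kn.
rewrite (nth_map k0) ?size_enum_ord // -[k]/(val (Ordinal kn)) nth_ord_enum.
have /rows : nth [::] b k \in b by rewrite mem_nth ?sz.
rewrite inE mem_words_over => /andP[/eqP szr _].
apply: (@eq_from_nth _ BlankTile); first by rewrite size_map size_enum_ord.
rewrite szr => j jn; rewrite (nth_map k0) ?size_enum_ord //.
by rewrite -[j]/(val (Ordinal jn)) nth_ord_enum mxE rev_ordK.
Qed.

Lemma board_mem D : board D \in words_over (words_over tiles n) n.
Proof.
rewrite mem_words_over size_map size_enum_ord eqxx /=.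
apply/allP => r /mapP[k _ ->]; rewrite inE mem_words_over size_map size_enum_ord eqxx /=.
by apply/allP => t _; apply: mem_tiles.
Qed.

Lemma row_blanksE D i :
  row_blanks D i = count_mem BlankTile [seq D i j | j <- enum 'I_n].
Proof.
rewrite /row_blanks -sum1_card count_map -sum1_count big_enum_cond /=.
by apply: eq_bigl => j; rewrite inE.
Qed.

Local Open Scope ring_scope.

(** Boards store rows from the bottom and diagrams from the top, hence the reindexing by
    [rev_ord]. *)
Lemma schubert_bpd_sum (R : comNzRingType) (x : nat -> R) w :
  schubert x w = \sum_(D : 'M[tile]_n | is_bpd D && has_perm D w)
                   \prod_(i < n) x i ^+ row_blanks D i.
Proof.
rewrite /schubert boards_sumE size_map size_iota size_rev /perm_word size_map size_enum_ord.
rewrite -/(perm_word w).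
have perm : perm_eq (words_over (words_over tiles n) n)
                    (map board (index_enum 'M[tile]_n)).
  apply: uniq_perm.
  - by rewrite !words_over_uniq ?tiles_uniq.
  - by rewrite map_inj_uniq ?index_enum_uniq //; apply: board_inj.
  - move=> b; apply/idP/mapP => [/board_surj[D ->]|[D _ ->]]; last exact: board_mem.
    by exists D; rewrite ?mem_index_enum.
rewrite (perm_big _ perm) big_map; apply: eq_big => [D|D _]; first exact: board_okE.
rewrite board_weightE size_map size_enum_ord (reindex_inj rev_ord_inj) /=.
apply: eq_bigr => i _; rewrite (nth_map i) ?size_enum_ord ?(ltn_ord (rev_ord i)) //.
rewrite -[(n - i.+1)%N]/(nat_of_ord (rev_ord i)) nth_ord_enum rev_ordK -row_blanksE.
by have -> : (n - (rev_ord i).+1)%N = i by have := rev_ordK i => /(congr1 val).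
Qed.

End BoardOfDiagram.

(** * Bruhat covers *)

Section BruhatCovers.

Variable n : nat.
Implicit Types (u v w : 'S_n) (a b c i j : 'I_n).

Local Open Scope ring_scope.

Lemma perm_lengthE u :
  (perm_length u)%:R = \sum_(i < n) \sum_(j < n) ((i < j) && (u j < u i))%N%:R :> int.
Proof.
rewrite /perm_length -sum1_card big_mkcond /= natr_sum pair_bigA /=.
by apply: eq_bigr => -[i j] _; rewrite inE /=; case: (_ && _).
Qed.

Lemma sum_pairs_meeting (G : 'I_n -> 'I_n -> int) a b : a != b ->
    (forall i, G i i = 0) ->
    (forall i j, i != a -> i != b -> j != a -> j != b -> G i j = 0) ->
  \sum_i \sum_j G i j = G a b + G b a +
    \sum_(c | (c != a) && (c != b)) (G a c + G b c + (G c a + G c b)).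
Proof.
move=> ab G0 Gout; have ba : b != a by rewrite eq_sym.
have Ga : \sum_j G a j = G a b + \sum_(c | (c != a) && (c != b)) G a c.
  by rewrite (bigD1 a) //= G0 add0r (bigD1 b).
have Gb : \sum_j G b j = G b a + \sum_(c | (c != a) && (c != b)) G b c.
  by rewrite (bigD1 a) //= (bigD1 b) //= G0 add0r.
have Gc c : (c != a) && (c != b) -> \sum_j G c j = G c a + G c b.
  case/andP=> ca cb; rewrite (bigD1 a) //= (bigD1 b) //= big1 ?addr0 //.
  by move=> j /andP[ja jb]; apply: Gout.
rewrite (bigD1 a) //= [X in _ + X](bigD1 b) //= Ga Gb (eq_bigr _ Gc) !big_split /=.
by ring.
Qed.

(** After reindexing by the transposition only pairs meeting [a] or [b] change. The pair itself
    contributes 1, and a third position contributes 2 if it lies in the rectangle and 0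
    otherwise. *)
Lemma perm_length_tperm u a b : (a < b)%N -> (u a < u b)%N ->
  (perm_length (mul_tperm u a b))%:R = (perm_length u)%:R + 1 +
    \sum_(c | (c != a) && (c != b)) 2 * ((a < c < b) && (u a < u c < u b))%N%:R :> int.
Proof.
move=> ab uab; set t := tperm a b.
have nab : a != b by rewrite -val_eqE /= ltn_eqF.
have lenw : (perm_length (mul_tperm u a b))%:R =
    \sum_(i < n) \sum_(j < n) ((t i < t j) && (u j < u i))%N%:R :> int.
  rewrite perm_lengthE (reindex_inj (@perm_inj _ t)); apply: eq_bigr => i _.
  rewrite (reindex_inj (@perm_inj _ t)); apply: eq_bigr => j _.
  by rewrite !mul_tpermE !tpermK.
pose G i j : int := ((t i < t j) && (u j < u i))%N%:R - ((i < j) && (u j < u i))%N%:R.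
suff : (perm_length (mul_tperm u a b))%:R - (perm_length u)%:R =
    1 + \sum_(c | (c != a) && (c != b)) 2 * ((a < c < b) && (u a < u c < u b))%N%:R :> int.
  by move/eqP; rewrite subr_eq => /eqP ->; ring.
rewrite lenw perm_lengthE -sumrB.
under eq_bigr => i _ do rewrite -sumrB.
rewrite (@sum_pairs_meeting G a b) // /G; last first.
- by move=> i j ia ib ja jb; rewrite /t !tpermD 1?eq_sym // subrr.
- by move=> i; rewrite !ltnn subrr.
congr (_ + _).
  by rewrite /t tpermL tpermR ab uab [(b < a)%N]ltnNge (ltnW ab) [(u b < u a)%N]ltnNge (ltnW uab).
apply: eq_bigr => c /andP[ca cb].
have -> : t c = c by rewrite /t tpermD // eq_sym.
rewrite /t tpermL tpermR.
have := ord_neq ca; have := ord_neq cb.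
have := @val_perm_neq _ u _ _ ca; have := @val_perm_neq _ u _ _ cb.
move: (nat_of_ord a) (nat_of_ord b) (nat_of_ord c) ab => A B C AB.
move: (nat_of_ord (u a)) (nat_of_ord (u b)) (nat_of_ord (u c)) uab => A' B' C' AB'.
by clear -AB AB'; lia.
Qed.

Lemma perm_length_tperm_lt u a b : (a < b)%N -> (u a < u b)%N ->
  (perm_length u < perm_length (mul_tperm u a b))%N.
Proof.
move=> ab uab; have := perm_length_tperm ab uab.
set S := \sum_(c | _) _ => E.
have S0 : (0 <= S)%R by apply: Num.Theory.sumr_ge0 => c _; case: (_ && _).
by move: E S0; clearbody S; lia.
Qed.

Lemma perm_length_covers u a b : covers_at u a b ->
  perm_length (mul_tperm u a b) = (perm_length u).+1.
Proof.
case/covers_atP=> ab uab gap; have := perm_length_tperm ab uab.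
rewrite big1 => [|c _]; first by lia.
by case: (boolP (a < c < b)%N) => //= /gap/negPf ->.
Qed.

Local Open Scope nat_scope.

Lemma bruhat_le_length u w : bruhat_le u w -> u = w \/ perm_length u < perm_length w.
Proof.
case/connectP=> p; elim/last_ind: p w => [|p v IH] w /=; first by move=> _ ->; left.
rewrite rcons_path last_rcons => /andP[pp /andP[lt _]] ->; right.
by case: (IH _ pp erefl) => [->//|lt']; apply: ltn_trans lt.
Qed.

Lemma bruhat_lt_length u w : bruhat_lt u w -> perm_length u < perm_length w.
Proof. by case/andP=> /eqP uw /bruhat_le_length[]. Qed.

Lemma bruhat_step_tperm u a b : a < b -> u a < u b -> bruhat_step u (mul_tperm u a b).
Proof.
move=> ab uab; rewrite /bruhat_step perm_length_tperm_lt //=.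
apply/existsP; exists a; apply/existsP; exists b.
by rewrite eqxx andbT -val_eqE /= ltn_eqF.
Qed.

Lemma bruhat_lt_of_length u w : bruhat_le u w -> perm_length u < perm_length w ->
  bruhat_lt u w.
Proof. by move=> le lt; rewrite /bruhat_lt le andbT; apply: contraTneq lt => ->; rewrite ltnn. Qed.

Lemma bruhat_coversE u a b : a < b ->
  bruhat_covers (mul_tperm u a b) u = covers_at u a b.
Proof.
move=> ab; have nab : a != b by rewrite -val_eqE /= ltn_eqF.
apply/andP/idP => [[lt_uw /existsPn noV]|cov]; last first.
  have [_ uab _] := covers_atP _ _ _ cov; split.
    apply: bruhat_lt_of_length; first exact/connect1/bruhat_step_tperm.
    exact: perm_length_tperm_lt.
  apply/existsPn => v; apply/negP => /andP[/bruhat_lt_length l1 /bruhat_lt_length].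
  by rewrite perm_length_covers // ltnS leqNgt l1.
have uab : u a < u b.
  case: (ltngtP (u a) (u b)) => // [uba|/ord_inj/perm_inj E]; last by rewrite E eqxx in nab.
  have := bruhat_lt_length lt_uw.
  have := @perm_length_tperm_lt (mul_tperm u a b) a b ab.
  rewrite mul_tpermL mul_tpermR => /(_ uba).
  have -> : mul_tperm (mul_tperm u a b) a b = u by rewrite /mul_tperm mulgA tperm2 mul1g.
  by move=> l1 l2; have := ltn_trans l1 l2; rewrite ltnn.
apply/covers_atP; split=> // c /andP[ac cb]; apply/negP => /andP[uac ucb].
have [nac ncb] : a != c /\ c != b by rewrite -!val_eqE /= !ltn_eqF.
have nbc : b != c by rewrite eq_sym.
have nca : c != a by rewrite eq_sym.
have nba : b != a by rewrite eq_sym.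
(* A point [c] inside the rectangle refutes the cover: [t_{a,b}] factors as [t_{a,c}], [t_{c,b}],
   [t_{a,c}], and each of the three successive swaps raises the length. *)
pose v := mul_tperm u a c; pose v1 := mul_tperm v c b.
have vb : v b = u b by rewrite /v mul_tpermD.
have va : v a = u c by rewrite /v mul_tpermL.
have vc : v c = u a by rewrite /v mul_tpermR.
have v1a : v1 a = u c by rewrite /v1 mul_tpermD.
have v1c : v1 c = u b by rewrite /v1 mul_tpermL.
have v1b : v1 b = u a by rewrite /v1 mul_tpermR.
have Ew : mul_tperm u a b = mul_tperm v1 a c.
  apply/permP => i.
  have [->|ia] := eqVneq i a; first by rewrite !mul_tpermL ?v1c ?vb.
  have [->|ib] := eqVneq i b; first by rewrite mul_tpermR [RHS]mul_tpermD.
  have [->|ic] := eqVneq i c; first by rewrite [RHS]mul_tpermR v1a mul_tpermD.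
  by rewrite !mul_tpermD // /v1 mul_tpermD // /v mul_tpermD.
have := noV v; rewrite negb_and => /orP[] /negP; apply; apply: bruhat_lt_of_length.
- exact/connect1/bruhat_step_tperm.
- exact: perm_length_tperm_lt.
- rewrite Ew; apply: connect_trans (connect1 (_ : bruhat_step v v1)) (connect1 _).
    by apply: bruhat_step_tperm; rewrite ?vc ?vb.
  by apply: bruhat_step_tperm; rewrite ?v1a ?v1c.
- rewrite Ew; apply: (@ltn_trans (perm_length v1)); apply: perm_length_tperm_lt => //.
    by rewrite vc vb.
  by rewrite v1a v1c.
Qed.

End BruhatCovers.

(** * From generating functions to a bijection *)

Section Fibres.

Local Open Scope ring_scope.

(** The element of rank [i] in a fibre of [f] goes to the element of rank [i] in the fibre of [g]
    over the same point. *)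
Lemma injection_of_fibres (A B : finType) (C : eqType) (f : A -> C) (g : B -> C) :
    (forall m, #|[pred a | f a == m]| <= #|[pred b | g b == m]|)%N ->
  exists2 Phi : A -> B, injective Phi & forall a, g (Phi a) = f a.
Proof.
move=> lec; have fib a : a \in [pred a' | f a' == f a] by rewrite inE /=.
pose Phi a := enum_val (widen_ord (lec (f a)) (enum_rank_in (fib a) a)).
have gPhi a : g (Phi a) = f a.
  by have := enum_valP (widen_ord (lec (f a)) (enum_rank_in (fib a) a)); rewrite inE => /eqP.
exists Phi => // a1 a2 E; have Ef : f a1 = f a2 by rewrite -(gPhi a1) E gPhi.
have in2 : a2 \in [pred a' | f a' == f a1] by rewrite inE /= Ef.
move: E; rewrite /Phi; move: (fib a1) (fib a2) (lec (f a1)) (lec (f a2)).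
rewrite -Ef => in1 in2' le1 le2; rewrite (bool_irrelevance le2 le1) => /enum_val_inj.
move=> /(congr1 val) /= /val_inj/(congr1 enum_val).
by rewrite !enum_rankK_in.
Qed.

Lemma bijection_of_fibres (A B : finType) (C : eqType) (f : A -> C) (g : B -> C) :
    (forall m, #|[pred a | f a == m]| = #|[pred b | g b == m]|) ->
  exists2 Phi : A -> B, bijective Phi & forall a, g (Phi a) = f a.
Proof.
move=> eqc.
have [|Phi injPhi gPhi] := @injection_of_fibres A B C f g; first by move=> m; rewrite eqc.
have [|Psi injPsi _] := @injection_of_fibres B A C g f; first by move=> m; rewrite eqc.
by exists Phi => //; apply: inj_card_bij injPhi (leq_card _ injPsi).
Qed.

Lemma sum_sig (V : nmodType) (T : finType) (P : pred T) (F : T -> V) :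
  \sum_(z : {z : T | P z}) F (val z) = \sum_(z | P z) F z.
Proof. by symmetry; apply: (big_sub P F). Qed.

(** With integer coefficients, the coefficient of a monomial is the size of its fibre. *)
Lemma mpoly_sum_fibres n (A B : finType) (f : A -> 'X_{1..n}) (g : B -> 'X_{1..n}) :
    \sum_a 'X_[f a] = \sum_b 'X_[g b] :> {mpoly int[n]} ->
  forall m, #|[pred a | f a == m]| = #|[pred b | g b == m]|.
Proof.
move=> eqfg m.
have coef (T : finType) (h : T -> 'X_{1..n}) :
    mcoeff m (\sum_z 'X_[h z] : {mpoly int[n]}) = #|[pred z | h z == m]|%:R.
  rewrite raddf_sum /= -sum1_card natr_sum [RHS]big_mkcond /=.
  by apply: eq_bigr => z _; rewrite mcoeffX inE /=; case: eqP.
have := congr1 (mcoeff m) eqfg; rewrite !coef => /eqP.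
by rewrite !pmulrn => /eqP/intr_inj [].
Qed.

End Fibres.

Section MonkBijection.

Local Open Scope ring_scope.

Variables (n : nat) (pi : 'S_n) (al : 'I_n).

Definition blank_monomial (D : 'M[tile]_n) : 'X_{1..n} :=
  [multinom row_blanks D i | i < n].

(** The type [BPD w] with its finite structure; the two are convertible, so a bijection built here
    is one for the types of the theorem. *)
Definition bpd_type (w : 'S_n) : finType := {D : 'M[tile]_n | is_bpd D && has_perm D w}.

Definition lower_type : finType :=
  {k : {k : 'I_n | (k < al)%N && bruhat_covers (mul_tperm pi k al) pi} &
    bpd_type (mul_tperm pi (sval k) al)}.

Definition upper_type : finType :=
  {l : {l : 'I_n | (al < l)%N && bruhat_covers (mul_tperm pi l al) pi} &
    bpd_type (mul_tperm pi (sval l) al)}.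

(** The factor [U_(al)] encodes the additional blank required in row [al], so preserving monomials
    is exactly the condition on row counts. *)
Definition source_monomial (z : (bpd_type pi + lower_type)%type) : 'X_{1..n} :=
  match z with
  | inl D => (U_(al) + blank_monomial (sval D))%MM
  | inr D => blank_monomial (sval (tagged D))
  end.

Definition target_monomial (z : upper_type) : 'X_{1..n} :=
  blank_monomial (sval (tagged z)).

Definition row_variable (i : nat) : {mpoly int[n]} :=
  if insub i is Some i' then 'X_(i' : 'I_n) else 0.

Lemma schubert_mpoly (w : 'S_n) :
  schubert row_variable w = \sum_(D : bpd_type w) 'X_[blank_monomial (val D)].
Proof.
rewrite schubert_bpd_sum -(sum_sig _ (fun D => \prod_(i < n) row_variable i ^+ row_blanks D i)).
apply: eq_bigr => D _; rewrite mpolyXE_id; apply: eq_bigr => i _.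
by rewrite /row_variable valK mnmE.
Qed.

Lemma upper_coversE (l : 'I_n) :
  (al < l)%N && bruhat_covers (mul_tperm pi l al) pi = covers_at pi al l.
Proof.
case: (ltnP al l) => [all_|lal] /=; first by rewrite mul_tpermC bruhat_coversE.
by apply/esym/negP => /covers_atP[]; rewrite ltnNge lal.
Qed.

Lemma lower_coversE (k : 'I_n) :
  (k < al)%N && bruhat_covers (mul_tperm pi k al) pi = covers_at pi k al.
Proof.
case: (ltnP k al) => [kal|alk] /=; first by rewrite bruhat_coversE.
by apply/esym/negP => /covers_atP[]; rewrite ltnNge alk.
Qed.

Lemma monk_monomials : ascends_after pi al ->
  \sum_z 'X_[source_monomial z] = \sum_z 'X_[target_monomial z] :> {mpoly int[n]}.
Proof.
move=> asc.
(* Vacuous at [n], so [monk] applies to an arbitrary [pi]. *)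
have inc : increasing_from n pi.
  by move=> i j ni; have := leq_ltn_trans ni (ltn_ord i); rewrite ltnn.
have := monk row_variable inc asc; rewrite bruhat_operatorE => E.
rewrite big_sumType /=.
have -> : \sum_(D : bpd_type pi) 'X_[U_(al) + blank_monomial (sval D)] =
    row_variable al * schubert row_variable pi.
  rewrite schubert_mpoly mulr_sumr /row_variable valK.
  by apply: eq_bigr => D _; rewrite mpolyXD.
have -> : \sum_(z : lower_type) 'X_[blank_monomial (sval (tagged z))] =
    \sum_(k | covers_at pi k al) schubert row_variable (mul_tperm pi k al).
  rewrite -(eq_bigl _ _ lower_coversE) -(sum_sig _ (fun k => schubert row_variable (mul_tperm pi k al))).
  under [RHS]eq_bigr => k _ do rewrite schubert_mpoly.
  by rewrite (sig_big_dep (fun=> true) (fun _ _ => true)).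
have -> : \sum_(z : upper_type) 'X_[target_monomial z] =
    \sum_(l | covers_at pi al l) schubert row_variable (mul_tperm pi al l).
  rewrite -(eq_bigl _ _ upper_coversE) -(sum_sig _ (fun l => schubert row_variable (mul_tperm pi al l))).
  under [RHS]eq_bigr => l _ do rewrite (mul_tpermC pi al) schubert_mpoly.
  by rewrite (sig_big_dep (fun=> true) (fun _ _ => true)).
by rewrite E subrK.
Qed.

End MonkBijection.

Theorem mainTheorem1 (n : nat) (hn : 1 <= n) (pi : 'S_n)
    (alpha : 'I_n) (halpha : alpha.+1 < n)
    (hl : exists l : 'I_n, alpha < l /\ bruhat_covers (mul_tperm pi alpha l) pi) :
  exists Phi : (BPD pi + lower_BPD pi alpha)%type -> upper_BPD pi alpha,
    [/\ bijective Phi,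
        forall D : BPD pi,
          (forall i : 'I_n, i != alpha ->
             row_blanks (sval (projT2 (Phi (inl D)))) i = row_blanks (sval D) i) /\
          row_blanks (sval (projT2 (Phi (inl D)))) alpha =
             (row_blanks (sval D) alpha).+1
      & forall (k : lower_index pi alpha)
               (D : BPD (mul_tperm pi (sval k) alpha)) (i : 'I_n),
          row_blanks (sval (projT2 (Phi (inr (existT _ k D))))) i =
            row_blanks (sval D) i].
Proof.
have asc : ascends_after pi alpha.
  case: hl => l [all_]; rewrite bruhat_coversE // => /covers_atP[_ ul _].
  by exists l.
have [Phi bijPhi wt] := bijection_of_fibres (mpoly_sum_fibres (monk_monomials asc)).
have wtE z i : row_blanks (sval (projT2 (Phi z))) i = source_monomial z i.
  by rewrite -wt mnmE.
exists Phi; split=> // [D|k D i]; last by rewrite wtE mnmE.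
by split=> [i ia|]; rewrite wtE mnmDE mnm1E mnmE ?eqxx // eq_sym (negPf ia).
Qed.
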